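(* Let $\{\omega_x\}_{x\in\mathbb Z^2}$ be independent rate $1$ exponentially distributed random variables. Then $$\lim_{M\to\infty}\ \max_{x\in\mathbb Z_{\ge0}^2:\,|x|_1=M}\ \frac{D_{0,x}}{|x|_1}=0\qquad\text{in probability.}$$
   Context: $|x|_1=|x_1|+|x_2|$. For $x\le y$ (coordinatewise) in $\mathbb Z^2$, $G_{x,y}=\max\sum_{k=0}^{|y-x|_1}\omega_{x_k}$, the maximum being over up-right lattice paths $(x_k)_{k=0}^{|y-x|_1}$ from $x_0=x$ to $y$ with increments in $\{(1,0),(0,1)\}$. Let $\pi^{x,y}=(\pi^{x,y}_i)_{i=0}^{|y-x|_1}$ be the (almost surely unique) maximizing path (geodesic) for $G_{x,y}$, and for $x\ne y$ $$D_{x,y}=\max_{0\le i\le|y-x|_1}\Bigl|\pi^{x,y}_i-\frac{|y-x|_1-i}{|y-x|_1}\,x-\frac{i}{|y-x|_1}\,y\Bigr|_1.$$ *)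

(* Defs.v *)
From HB Require Import structures.
From mathcomp Require Import all_boot all_order all_algebra.
From mathcomp Require Import all_classical all_reals all_analysis.

Set Implicit Arguments.
Unset Strict Implicit.
Unset Printing Implicit Defensive.

Import Order.TTheory GRing.Theory Num.Theory.
Import numFieldNormedType.Exports.

Local Open Scope classical_set_scope.
Local Open Scope ring_scope.

Definition mutually_independent (R : realType) (d : measure_display)
    (T : measurableType d) (P : probability T R) (I : eqType)
    (X : I -> {RV P >-> R}) : Prop :=
  forall (s : seq I) (A : I -> set R), uniq s ->
    (forall i, measurable (A i)) ->
    P (\bigcap_(i in [set` s]) (X i @^-1` A i)) =
    (\prod_(i <- s) P (X i @^-1` A i))%E.

Definition has_exponential_law (R : realType) (d : measure_display)
    (T : measurableType d) (P : probability T R) (rate : R)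
    (X : {RV P >-> R}) : Prop :=
  forall A : set R, measurable A ->
    distribution P X A = exponential_prob rate A.

Definition cvg_in_probability (R : realType) (d : measure_display)
    (T : measurableType d) (P : probability T R)
    (X : nat -> T -> R) (Y : T -> R) : Prop :=
  forall eps : R, 0 < eps ->
    P [set t | eps < `|X n t - Y t|] @[n --> \oo] --> 0%E.

Notation site := (int * int)%type.

(* The canonical norm of a product type is the sup norm, hence the explicit
   l^1 norms on Z^2 and R^2. *)
Definition norm1Z (x : site) : nat := (`|x.1| + `|x.2|)%N.

Definition norm1R (R : realType) (u : R * R) : R := `|u.1| + `|u.2|.

Definition up_right_step : rel site :=
  fun x y => (y - x == (1, 0)) || (y - x == (0, 1)).

(* [p] stands for the lattice path [x :: p]; its length [size p] is
   necessarily [norm1Z (y - x)]. *)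
Definition up_right_paths (x y : site) : set (seq site) :=
  [set p | path up_right_step x p /\ last x p = y].

Definition path_weight (R : realType) (w : site -> R) (x : site)
    (p : seq site) : R :=
  \sum_(z <- x :: p) w z.

(* There are finitely many paths from [x] to [y], and at least one when
   [x <= y], so that this supremum is a maximum. *)
Definition last_passage (R : realType) (w : site -> R) (x y : site) : R :=
  sup [set path_weight w x p | p in up_right_paths x y].

Definition maximizing_paths (R : realType) (w : site -> R) (x y : site) :
    set (seq site) :=
  [set p | up_right_paths x y p /\ path_weight w x p = last_passage w x y].

(* All the sites of the geodesic, starting point included.  For i.i.d.
   exponential weights the maximizing path is almost surely unique; [xget]
   picks one of them in case of a tie. *)
Definition geodesic (R : realType) (w : site -> R) (x y : site) : seq site :=
  x :: xget [::] (maximizing_paths w x y).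

(* The point ((n - i) x + i y) / n of R^2. *)
Definition segment_point (R : realType) (n i : nat) (x y : site) : R * R :=
  ((n%:R - i%:R) / n%:R * x.1%:~R + i%:R / n%:R * y.1%:~R,
   (n%:R - i%:R) / n%:R * x.2%:~R + i%:R / n%:R * y.2%:~R).

Definition geodesic_deviation (R : realType) (w : site -> R) (x y : site) : R :=
  let n := norm1Z (y - x) in
  \big[Num.max/0]_(0 <= i < n.+1)
    let z := nth x (geodesic w x y) i in
    norm1R ((z.1%:~R, z.2%:~R) - segment_point R n i x y).

(* A maximum too: finitely many sites [x], and at least one for each [M]. *)
Definition max_relative_deviation (R : realType) (w : site -> R) (M : nat) : R :=
  sup [set geodesic_deviation w 0 x / (norm1Z x)%:R
        | x in [set x : site | [/\ 0 <= x.1, 0 <= x.2 & norm1Z x = M]]].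

(* Main.v *)
(* The proof compares exponential last-passage percolation with its stationary version.
   Enlarging the boundary weights on the left column and on the bottom line to the rates
   [1 - u] and [u] makes the passage times larger, and by Burke's property the increments
   along any row are again independent exponentials of rate [u].  The stationary passage
   time to [(p, q)] is therefore [p / u + q / (1 - u)] up to exponentially unlikely linear
   errors; optimizing over [u] bounds the point-to-point passage time from above by
   [(sqrt p + sqrt q) ^ 2], for all pairs of points at once.  Conversely, at the optimal
   [u], a stationary geodesic leaving the boundary at a macroscopic distance would, by the
   upper bound and strict concavity, be too light, so it leaves the boundary early and the
   upper bound is sharp.  Finally, a point of the geodesic far from the segment would make
   the sum of the two passage times it separates smaller, by strict concavity, than the
   passage time between the end points. *)

Require Import Defs.
From HB Require Import structures.
From mathcomp Require Import all_boot all_order all_algebra.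
From mathcomp Require Import all_classical all_reals all_analysis.
From mathcomp Require Import measurable_realfun.
From mathcomp Require Import zify ring lra.

Set Implicit Arguments.
Unset Strict Implicit.
Unset Printing Implicit Defensive.

Import Order.TTheory GRing.Theory Num.Theory.
Import numFieldNormedType.Exports.

Local Open Scope classical_set_scope.
Local Open Scope ring_scope.

(** * Densities and exponential laws *)

(** Probability enters through a single union bound: at most [3 * (n + 1) ^ 4] statements
    [stationary_typical], one for each starting site, size and slope, each failing with
    exponentially small probability. On the event that all of them hold, and that all weights are
    nonnegative, everything is deterministic. All stationary environments are rescalings of the one
    field [omega], so no additional randomness is introduced. The obstacle is the degeneration of
    the optimal slope near the axes, where a boundary rate tends to 0. Slopes are therefore kept at
    distance [eta / 4] from 0 and 1. The sums are controlled up to [eta ^ 2 * N], because boundary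
    factors of order [1 / eta] turn this into [eta * N]. The exit argument bounds the square of a
    loss and so leaves [sqrt eta * N]; the concavity gap is again quadratic in the deviation. Hence
    [eta] is of order [eps ^ 4]. Burke's property is a sequence of flips acting in place on one
    index set: every flip preserves independence and all the marginals, so these form an invariant
    of the induction. *)

Section density.
Context d1 d2 (T1 : measurableType d1) (T2 : measurableType d2) (R : realType).
Variables (m : {measure set T1 -> \bar R}) (nu : {measure set T2 -> \bar R}).
Variables (phi : T1 -> T2) (g : T1 -> R).
Hypothesis mphi : measurable_fun setT phi.
Hypothesis mg : measurable_fun setT g.
Hypothesis g0 : forall x, 0 <= g x.
Hypothesis nuE : forall A, measurable A ->
  nu A = (\int[m]_(x in phi @^-1` A) (g x)%:E)%E.

Import HBNNSimple.

Let integral_pushforward_density_nnsfun (h : {nnsfun T2 >-> R}) :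
  (\int[nu]_y (h y)%:E = \int[m]_x ((h (phi x))%:E * (g x)%:E))%E.
Proof.
under [LHS]eq_integral do rewrite fimfunE -fsumEFin//.
rewrite [LHS]ge0_integral_fsum//; last 2 first.
  - by move=> r; exact/measurable_EFinP/measurableT_comp.
  - by move=> n x _; rewrite EFinM nnfun_muleindic_ge0.
under [RHS]eq_integral.
  move=> x xD; rewrite fimfunE -fsumEFin// muleC ge0_mule_fsumr; last first.
    by move=> r; rewrite EFinM nnfun_muleindic_ge0.
  over.
rewrite [RHS]ge0_integral_fsum//; last 2 first.
  - move=> r; apply/emeasurable_funM; first exact/measurable_EFinP.
    apply/measurable_EFinP; apply/measurable_funM => //.
    by apply: (measurableT_comp _ mphi) => //; exact: measurable_indic.
  - by move=> n x _; apply: mule_ge0; rewrite ?nnfun_muleindic_ge0 ?lee_fin.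
apply: eq_fsbigr => r _; rewrite integralZl_indic_nnsfun//= integral_indic// setIT.
rewrite nuE//.
have [r0|r0] := ltP r 0.
  rewrite preimage_nnfun0// preimage_set0 integral_set0 mule0.
  by rewrite integral0_eq// => x _; rewrite indic0 mulr0 mule0.
have mpre : measurable (phi @^-1` (h @^-1` [set r])).
  by rewrite -[X in measurable X]setTI; exact: mphi.
rewrite integral_mkcond -ge0_integralZl ?lee_fin//; last 2 first.
  - by apply/(measurable_restrictT _ _).1 => //; exact/measurable_EFinP/measurable_funTS.
  - by move=> x _; rewrite patchE; case: ifP => // _; rewrite lee_fin.
apply: eq_integral => x _; rewrite patchE indicE.
rewrite (_ : (phi x \in h @^-1` [set r]) = (x \in phi @^-1` (h @^-1` [set r])))//.
case: ifP => _; rewrite ?mulr1 ?mulr0 ?mule0//.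
by rewrite muleC.
Qed.

(** Simple functions, then monotone convergence. It serves with [phi := id] as a density formula,
    and with [phi] a random variable and [g] the product of the remaining factors, to peel one
    factor off the expectation of a product. *)
Lemma integral_pushforward_density (f : T2 -> \bar R) : measurable_fun setT f ->
  (forall y, 0 <= f y)%E ->
  (\int[nu]_y f y = \int[m]_x (f (phi x) * (g x)%:E))%E.
Proof.
move=> mf f0; pose f_ := nnsfun_approx measurableT mf.
transitivity (limn (fun n => \int[nu]_x (f_ n x)%:E)%E).
  rewrite -monotone_convergence//=.
  - apply: eq_integral => x _; apply/esym/cvg_lim => //=.
    exact: cvg_nnsfun_approx.
  - by move=> n; exact/measurable_EFinP.
  - by move=> n x _; rewrite lee_fin.
  - by move=> x _ a b ab; rewrite lee_fin//; exact/lefP/nd_nnsfun_approx.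
transitivity (limn (fun n => \int[m]_x ((f_ n (phi x))%:E * (g x)%:E))%E).
  congr (limn _); apply/funext => n.
  exact: integral_pushforward_density_nnsfun.
rewrite -monotone_convergence//=.
- apply: eq_integral => x _; apply/cvg_lim => //=.
  apply: cvgeZr => //; exact: cvg_nnsfun_approx.
- move=> n; apply/emeasurable_funM; apply/measurable_EFinP => //.
  exact: measurableT_comp.
- by move=> n x _; rewrite mule_ge0 ?lee_fin.
- move=> x _ a b ab; apply: lee_wpmul2r; rewrite ?lee_fin//.
  exact/lefP/nd_nnsfun_approx.
Qed.

End density.

Lemma integral_density d (T : measurableType d) (R : realType)
    (m nu : {measure set T -> \bar R}) (g : T -> R) (f : T -> \bar R) :
  measurable_fun setT g -> (forall x, 0 <= g x) ->
  (forall A, measurable A -> nu A = (\int[m]_(x in A) (g x)%:E)%E) ->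
  measurable_fun setT f -> (forall x, 0 <= f x)%E ->
  (\int[nu]_x f x = \int[m]_x (f x * (g x)%:E))%E.
Proof.
by move=> mg g0 nuE; exact: (integral_pushforward_density (phi := id)).
Qed.

(** Open right rays are stable under intersection, generate the Borel sets, and exhaust the line
    along []- n, +oo[]. *)
Lemma measure_eq_ray (R : realType)
    (m1 m2 : {measure set (measurableTypeR R) -> \bar R}) :
  (forall x, m1 `]x, +oo[%classic < +oo)%E ->
  (forall x : R, m1 `]x, +oo[%classic = m2 `]x, +oo[%classic) ->
  forall A, measurable A -> m1 A = m2 A.
Proof.
move=> fin1 m12 A mA.
pose G : set (set (measurableTypeR R)) := [set `]x, +oo[%classic | x in [set: R]].
apply: (@measure_unique _ R (measurableTypeR R) G (fun n => `](- n%:R)%R, +oo[%classic)) => //.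
- rewrite RGenOInfty.measurableE.
  congr (<<s _ >>); rewrite predeqE => B; split.
    by case=> x ->; exists x.
  by case=> x _ <-; exists x.
- move=> _ _ [x _ <-] [y _ <-]; exists (Num.max x y) => //.
  by rewrite predeqE => z /=; rewrite !in_itv/= !andbT gt_max; split => [/andP|/andP].
- by move=> n; exists (- n%:R).
- rewrite predeqE => x; split => // _.
  exists (Num.bound `|x|) => //=; rewrite in_itv/= andbT ltrNl.
  rewrite (le_lt_trans _ (archi_boundP (normr_ge0 x)))//.
  by rewrite -normrN ler_norm.
- by move=> B [x _ <-].
Qed.

Section exponential_law.
Context (R : realType).
Implicit Types (a : R) (m : probability (measurableTypeR R) R).

Definition is_exp a m := forall A, measurable A -> m A = exponential_prob a A.

Lemma integral_is_exp a m (f : R -> \bar R) : 0 < a -> is_exp a m ->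
  measurable_fun [set: measurableTypeR R] f -> (forall x, 0 <= f x)%E ->
  (\int[m]_x f x =
   \int[@lebesgue_measure R]_x (f x * (exponential_pdf a x)%:E))%E.
Proof.
move=> a0 ma mf f0.
apply: (integral_density (m := @lebesgue_measure R) (g := exponential_pdf a)) => //.
- exact: measurable_exponential_pdf.
- by move=> x; rewrite exponential_pdf_ge0// ltW.
Qed.

Lemma exponential_prob_ray a b x : 0 < a -> 0 <= x ->
  exponential_prob a [set` Interval (BSide b x) +oo%O] = (expR (- a * x))%:E.
Proof.
move=> a0 x0.
have mf (D : set R) : measurable_fun D (EFin \o exponential_pdf a).
  by apply/measurable_EFinP/measurable_funTS; exact: measurable_exponential_pdf.
suff E : exponential_prob a `[x, +oo[%classic = (expR (- a * x))%:E.
  by case: b => //; rewrite /exponential_prob integral_itv_obnd_cbnd.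
have cex : continuous (fun z : R^o => expR (- a * z)).
  move=> z; apply: continuous_comp; last exact: continuous_expR.
  by apply: continuousM => //; apply: (@continuousN _ R^o); exact: cst_continuous.
rewrite /exponential_prob (@ge0_continuous_FTC2y _ _ (fun x => - (expR (- a * x))) _ 0)//.
- by rewrite EFinN oppeK add0e.
- by move=> y _; apply: exponential_pdf_ge0; exact: ltW.
- apply: (@continuous_subspaceW R^o _ _ [set` `[0, +oo[%R]).
    by apply: subset_itvr; rewrite bnd_simp.
  exact: within_continuous_exponential_pdf.
- rewrite -oppr0; apply: cvgN.
  rewrite (_ : (fun x => expR (- a * x)) =
               (fun z => expR (- z)) \o (fun z => a * z)); last first.
    by apply: eq_fun => y; rewrite mulNr.
  apply: (@cvg_comp _ _ _ _ _ _ (pinfty_nbhs R)); last exact: cvgr_expR.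
  exact: gt0_cvgMry.
- by apply: cvgN; apply/cvg_at_right_filter; exact: cex.
- move=> z; rewrite in_itv/= andbT => xz.
  by apply: derive1_exponential_pdf; rewrite in_itv/= andbT (le_lt_trans x0).
Qed.

Lemma is_exp_ray a m b x : 0 < a -> is_exp a m -> 0 <= x ->
  m [set` Interval (BSide b x) +oo%O] = (expR (- a * x))%:E.
Proof. by move=> a0 ma x0; rewrite ma// exponential_prob_ray. Qed.

Lemma is_exp_ray_lt0 a m b x : 0 < a -> is_exp a m -> x < 0 ->
  m [set` Interval (BSide b x) +oo%O] = 1%E.
Proof.
move=> a0 ma x0; apply/eqP; rewrite eq_le probability_le1//=.
have <- : m `[0, +oo[%classic = 1%E.
  by rewrite (is_exp_ray _ a0 ma)// mulr0 expR0.
apply: le_measure; rewrite ?inE//.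
by move=> z; case: b; rewrite /= !in_itv/= !andbT => z0;
  rewrite ?(ltW (lt_le_trans x0 z0)) ?(lt_le_trans x0 z0).
Qed.

Definition exponential_law a (a0 : 0 < a) : probability (measurableTypeR R) R :=
  exponential_distribution_exponential_prob__canonical__probability_measure_Probability
    a0.

Lemma is_exp_exponential_law a (a0 : 0 < a) : is_exp a (exponential_law a0).
Proof. by []. Qed.

(** The restriction of [m] to the ray from [v], shifted back by [v], is [expR (- a * v)] times [m];
    this equality of measures is checked on rays. *)
Lemma integral_exp_memoryless a m b (v : R) (G : R -> \bar R) :
  0 < a -> is_exp a m -> 0 <= v ->
  measurable_fun [set: measurableTypeR R] G -> (forall x, 0 <= G x)%E ->
  (\int[m]_(u in [set` Interval (BSide b v) +oo%O]) G ((u : R) - v)%R =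
   (expR (- a * v))%:E * \int[m]_u G u)%E.
Proof.
move=> a0 ma v0 mG G0.
set I := [set` Interval (BSide b v) +oo%O].
have mI : measurable (I : set (measurableTypeR R)) by exact: measurable_itv.
pose sh : measurableTypeR R -> measurableTypeR R := fun u : R => (u - v)%R.
have msh : measurable_fun setT sh.
  by apply: (@measurable_funB _ (measurableTypeR R) R setT id (cst v)).

pose nu : {measure set (measurableTypeR R) -> \bar R} :=
  measure_function_pushforward__canonical__measure_function_Measure (mrestr m mI) msh.
pose k : {nonneg R} := NngNum (expR_ge0 (- a * v)).
transitivity (\int[nu]_u G u)%E.
  rewrite ge0_integral_pushforward// preimage_setT.
  rewrite (integral_density (m := m) (nu := mrestr m mI) (g := \1_I)) //.
  - rewrite [LHS]integral_mkcond; apply: eq_integral => x _.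
    by rewrite patchE indicE; case: ifP => _; rewrite ?mule1 ?mule0.
  - by move=> A mA; rewrite /mrestr integral_indic// setIC.
  - exact: measurableT_comp.
  - by move=> x; exact: G0.
transitivity (\int[mscale k m]_u G u)%E; last by rewrite ge0_integral_mscale.
apply: eq_measure_integral => A mA _; apply: measure_eq_ray => //.
  move=> x; rewrite /nu/= /pushforward /mrestr/=.
  rewrite (le_lt_trans (probability_le1 _ _)) ?ltry//; apply: measurableI => //.
  by rewrite -[X in measurable X]setTI; apply: (msh) => //; exact: measurable_itv.
move=> x; rewrite /nu/= /pushforward /mrestr/= /mscale/=.
have [x0|x0] := leP 0 x.
  rewrite (is_exp_ray _ a0 ma)// -EFinM -expRD.
  rewrite (_ : _ `&` _ = `]x + v, +oo[%classic).
    rewrite (is_exp_ray _ a0 ma) ?addr_ge0//; congr (expR _)%:E; ring.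
  rewrite predeqE => u; rewrite /I /sh /=; case: (b) => /=; rewrite !in_itv/= !andbT;
   (split => [[]|]; [lra|move=> ?; split; lra]).
rewrite (is_exp_ray_lt0 _ a0 ma)// mule1.
rewrite (_ : _ `&` _ = I); first by rewrite (is_exp_ray _ a0 ma).
rewrite predeqE => u; rewrite /I /sh /=; case: (b) => /=; rewrite !in_itv/= !andbT;
   (split => [[]//|?]; split; lra).
Qed.

End exponential_law.

(** * Burke's property *)

Section race.
Context (R : realType).
Notation mR := (measurableTypeR R).

(* [race b f] evaluates [f] at (lag, minimum) when the second clock rings first;
   [b] tells whether ties count. *)
Definition race (b : bool) (f : R * R -> \bar R) (z : R * R) : \bar R :=
  if z.1 \in Interval (BSide b z.2) +oo%O then f (z.1 - z.2, z.2) else 0%E.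

Lemma race_ge0 b f z : (forall z, 0 <= f z)%E -> (0 <= race b f z)%E.
Proof. by move=> f0; rewrite /race; case: ifP. Qed.

Lemma measurable_race b f : measurable_fun [set: mR * mR] f ->
  measurable_fun [set: mR * mR] (race b f).
Proof.
move=> mf.
apply: measurable_fun_ifT => //.
  rewrite (_ : (fun z => _) = (fun z : mR * mR => if b then z.2 <= z.1 else z.2 < z.1)%R); last first.
    by apply/funext => z; case: b; rewrite in_itv/= andbT.
  by case: b; [apply: measurable_fun_ler | apply: measurable_fun_ltr].
apply: (measurableT_comp mf); apply: measurable_fun_pair; last exact: measurable_snd.
by apply: measurable_funB; [exact: measurable_fst|exact: measurable_snd].
Qed.

(** Given that the second clock rings first, at time [v], the lag has rate [a] again by
    memorylessness, and the factor [expR (- a * v)] that this costs merges with the density of [v]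
    into [b] times the density of rate [a + b = 1]. So lag and minimum are independent. *)
Lemma integral_race (Ea Eb E1 : probability mR R) (a b : R) bb
    (f : R * R -> \bar R) :
  0 < a -> 0 < b -> a + b = 1 -> is_exp a Ea -> is_exp b Eb -> is_exp 1 E1 ->
  measurable_fun [set: mR * mR] f -> (forall z, 0 <= f z)%E ->
  (\int[Ea \x Eb]_z race bb f z = b%:E * \int[Ea \x E1]_z f z)%E.
Proof.
move=> a0 b0 ab eEa eEb eE1 mf f0.
have mr := measurable_race bb mf.
rewrite fubini_tonelli1//; last by move=> z; exact: race_ge0.
rewrite fubini_tonelli//; last by move=> z; exact: race_ge0.
rewrite [in RHS]fubini_tonelli1// [in RHS]fubini_tonelli//.
rewrite (integral_is_exp b0 eEb)//; last 2 first.
  by apply: measurable_fun_fubini_tonelli_G => // z; exact: race_ge0.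
  by move=> v; apply: integral_ge0 => u _; exact: race_ge0.
rewrite (integral_is_exp ltr01 eE1)//; last 2 first.
  exact: measurable_fun_fubini_tonelli_G.
  by move=> v; apply: integral_ge0.
rewrite -ge0_integralZl//; last 3 first.
- apply: emeasurable_funM; first exact: measurable_fun_fubini_tonelli_G.
  by apply/measurable_EFinP; exact: measurable_exponential_pdf.
- move=> v _; rewrite mule_ge0 ?integral_ge0// lee_fin exponential_pdf_ge0//.
- by rewrite lee_fin ltW.
apply: eq_integral => v _.
have [v0|v0] := ltP v 0; first by rewrite !lt0_exponential_pdf// !mule0.
rewrite !exponential_pdfE//.
under eq_integral => u _.
  rewrite (_ : race bb f (u, v) = ((fun u : R => f (u - v, v)) \_ [set` Interval (BSide bb v) +oo%O]) u); last first.
    by rewrite /race patchE/= inE/= mem_setE.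
  over.
rewrite -integral_mkcond.
rewrite (integral_exp_memoryless (G := fun d => f (d, v)) bb a0 eEa v0)//; last first.
  exact: measurableT_comp.
rewrite muleAC [RHS]muleCA [RHS]muleC -!EFinM; congr (EFin _ * _)%E.
rewrite mulrCA -expRD mul1r; congr (_ * expR _).
by rewrite -mulrDl -opprD ab.
Qed.

Lemma integral_swap (m1 m2 : probability mR R) (f : R * R -> \bar R) :
  measurable_fun [set: mR * mR] f -> (forall z, 0 <= f z)%E ->
  (\int[m1 \x m2]_z f (z.2, z.1) = \int[m2 \x m1]_z f z)%E.
Proof.
move=> mf f0; rewrite fubini_tonelli1//; last exact: (measurableT_comp mf (@measurable_swap _ _ _ _)).
by rewrite [RHS]fubini_tonelli1// [RHS]fubini_tonelli.
Qed.

(** The hypothesis on [f] describes it separately according to which clock rings first. The strict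
    race on one side and the large one on the other count each tie exactly once. *)
Lemma integral_race_split (Ea Eb E1 : probability mR R) (a b : R)
    (f f1 f2 : R * R -> \bar R) :
  0 < a -> 0 < b -> a + b = 1 -> is_exp a Ea -> is_exp b Eb -> is_exp 1 E1 ->
  measurable_fun [set: mR * mR] f1 -> measurable_fun [set: mR * mR] f2 ->
  (forall z, 0 <= f1 z)%E -> (forall z, 0 <= f2 z)%E ->
  (forall z, f z = race false f1 z + race true f2 (z.2, z.1))%E ->
  (\int[Ea \x Eb]_z f z =
   b%:E * \int[Ea \x E1]_z f1 z + a%:E * \int[Eb \x E1]_z f2 z)%E.
Proof.
move=> a0 b0 ab eEa eEb eE1 mf1 mf2 f10 f20 fE.
under eq_integral do rewrite fE.
rewrite ge0_integralD//=; last 4 first.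
- by move=> z _; exact: race_ge0.
- exact: measurable_race.
- by move=> z _; exact: race_ge0.
- exact: (measurableT_comp (measurable_race true mf2) (@measurable_swap _ _ _ _)).
rewrite (integral_race false a0 b0 ab eEa eEb eE1)// integral_swap; last 2 first.
  exact: measurable_race.
  by move=> z; exact: race_ge0.
rewrite addrC in ab.
by rewrite (integral_race true b0 a0 ab eEb eEa eE1).
Qed.

Lemma measurable_burke (A B C : set R) :
  measurable (A : set mR) -> measurable (B : set mR) -> measurable (C : set mR) ->
  measurable ([set z : (R * R) * R |
     [/\ A (z.2 + Num.max (z.1.1 - z.1.2) 0),
         B (z.2 + Num.max (z.1.2 - z.1.1) 0) &
         C (Num.min z.1.1 z.1.2)]] : set ((mR * mR) * mR)).
Proof.
move=> mA mB mC; set S := [set z | _].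
have m1 : measurable_fun [set: mR * mR] (fst : R * R -> R) by exact: measurable_fst.
have m2 : measurable_fun [set: mR * mR] (snd : R * R -> R) by exact: measurable_snd.
have m11 : measurable_fun [set: (mR * mR) * mR] (fun z : (R * R) * R => z.1.1).
  exact: (measurableT_comp m1 (@measurable_fst _ _ _ _)).
have m12 : measurable_fun [set: (mR * mR) * mR] (fun z : (R * R) * R => z.1.2).
  exact: (measurableT_comp m2 (@measurable_fst _ _ _ _)).
have m22 : measurable_fun [set: (mR * mR) * mR] (fun z : (R * R) * R => z.2).
  exact: measurable_snd.
have mp (f g : (R * R) * R -> R) (D : set R) : measurable_fun [set: (mR * mR) * mR] f ->
    measurable_fun [set: (mR * mR) * mR] g -> measurable (D : set mR) ->
    measurable ([set z | D (z.2 + Num.max (f z - g z) 0)] : set ((mR * mR) * mR)).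
  move=> mf mg mD.
  have mh : measurable_fun [set: (mR * mR) * mR]
      (fun z : (R * R) * R => z.2 + Num.max (f z - g z) 0).
    apply: measurable_funD => //; apply: measurable_maxr => //.
    exact: measurable_funB.
  by have := mh measurableT D mD; rewrite setTI.
have mq : measurable ([set z | C (Num.min z.1.1 z.1.2)] : set ((mR * mR) * mR)).
  have mh : measurable_fun [set: (mR * mR) * mR]
      (fun z : (R * R) * R => Num.min z.1.1 z.1.2) by exact: measurable_minr.
  by have := mh measurableT C mC; rewrite setTI.
rewrite (_ : S = [set z | A (z.2 + Num.max (z.1.1 - z.1.2) 0)] `&`
    [set z | B (z.2 + Num.max (z.1.2 - z.1.1) 0)] `&`
    [set z | C (Num.min z.1.1 z.1.2)]); last first.
  by apply/seteqP; split => z /=; [case|case; case].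
by apply: measurableI => //; apply: measurableI; apply: mp.
Qed.

(* On [U > V] the product density is a multiple of [exp (- a (U - V) - V - W)], and there
   the flip exchanges [V] and [W] while keeping [U - V]; similarly on [U <= V]. *)
Lemma burke_measure (Ea Eb E1 : probability mR R) (a b : R) (A B C : set R) :
  0 < a -> 0 < b -> a + b = 1 -> is_exp a Ea -> is_exp b Eb -> is_exp 1 E1 ->
  measurable (A : set mR) -> measurable (B : set mR) -> measurable (C : set mR) ->
  ((Ea \x Eb) \x E1)%E [set z : (R * R) * R |
     [/\ A (z.2 + Num.max (z.1.1 - z.1.2) 0),
         B (z.2 + Num.max (z.1.2 - z.1.1) 0) &
         C (Num.min z.1.1 z.1.2)]] = (Ea A * Eb B * E1 C)%E.
Proof.
move=> a0 b0 ab eEa eEb eE1 mA mB mC; set S := [set z | _].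
have mI (D : set R) : measurable (D : set mR) ->
    measurable_fun [set: mR] (\1_D : R -> R).
  by move=> mD; exact: measurable_indic.
have mA' : measurable_fun [set: mR] (\1_A : R -> R) by exact: mI.
have mB' : measurable_fun [set: mR] (\1_B : R -> R) by exact: mI.
have mC' : measurable_fun [set: mR] (\1_C : R -> R) by exact: mI.
have m1 : measurable_fun [set: mR * mR] (fst : R * R -> R) by exact: measurable_fst.
have m2 : measurable_fun [set: mR * mR] (snd : R * R -> R) by exact: measurable_snd.
have madd : measurable_fun [set: mR * mR] (fun z : R * R => z.2 + z.1).
  exact: measurable_funD.
have mS : measurable (S : set ((mR * mR) * mR)) by exact: measurable_burke.
have mk1 : measurable_fun [set: mR * mR]
    (fun z : R * R => (\1_A (z.2 + z.1) * \1_B z.2 : R)%:E).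
  have h : measurable_fun [set: mR * mR] (fun z : R * R => (\1_A (z.2 + z.1) * \1_B z.2) : R).
    apply: measurable_funM; first exact: (measurableT_comp mA' madd).
    exact: (measurableT_comp mB' m2).
  exact: (measurable_EFinP _ _).2 h.
have mk2 : measurable_fun [set: mR * mR]
    (fun z : R * R => (\1_A z.2 * \1_B (z.2 + z.1) : R)%:E).
  have h : measurable_fun [set: mR * mR] (fun z : R * R => (\1_A z.2 * \1_B (z.2 + z.1)) : R).
    apply: measurable_funM; first exact: (measurableT_comp mA' m2).
    exact: (measurableT_comp mB' madd).
  exact: (measurable_EFinP _ _).2 h.
have k10 z : (0 <= (\1_A (z.2 + z.1) * \1_B z.2 : R)%:E)%E by rewrite lee_fin mulr_ge0.
have k20 z : (0 <= (\1_A z.2 * \1_B (z.2 + z.1) : R)%:E)%E by rewrite lee_fin mulr_ge0.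
pose K1 (d : R) : \bar R := (\int[E1]_w (\1_A ((w : R) + d)%R * \1_B w : R)%:E)%E.
pose K2 (d : R) : \bar R := (\int[E1]_w (\1_A w * \1_B ((w : R) + d)%R : R)%:E)%E.
have mK1 : measurable_fun [set: mR] K1.
  by apply: (measurable_fun_fubini_tonelli_F (m2 := E1) (fun z : R * R => (\1_A (z.2 + z.1) * \1_B z.2 : R)%:E)).
have mK2 : measurable_fun [set: mR] K2.
  by apply: (measurable_fun_fubini_tonelli_F (m2 := E1) (fun z : R * R => (\1_A z.2 * \1_B (z.2 + z.1) : R)%:E)).
have K10 d : (0 <= K1 d)%E by apply: integral_ge0 => w _; exact: (k10 (d, w)).
have K20 d : (0 <= K2 d)%E by apply: integral_ge0 => w _; exact: (k20 (d, w)).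
have indE (D : set R) (x : R) : D x -> (\1_D x = 1 :> R).
  by move=> Dx; rewrite indicE mem_set.
(* Here the race decomposition is applied to the right-hand side, and the minimum of the two clocks
   takes the place of the third clock in [K1] and [K2]. The left-hand side, decomposed in the same
   way, produces the same two integrals times [E1 C]. *)
have -> : (Ea A * Eb B = b%:E * \int[Ea]_d K1 d + a%:E * \int[Eb]_d K2 d)%E.
  have -> : (Ea A * Eb B = \int[Ea \x Eb]_z (\1_A z.1 * \1_B z.2 : R)%:E)%E.
    rewrite -product_measure1E//.
    transitivity (\int[Ea \x Eb]_z (\1_(A `*` B) z)%:E)%E.
      by rewrite integral_indic ?setIT//; exact: measurableX.
    by apply: eq_integral => z _; rewrite !indicE in_setX -natrM mulnb.
  rewrite (integral_race_split (f1 := fun z => (\1_A (z.2 + z.1) * \1_B z.2 : R)%:E)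
    (f2 := fun z => (\1_A z.2 * \1_B (z.2 + z.1) : R)%:E) a0 b0 ab eEa eEb eE1)//.
    by rewrite !fubini_tonelli1.
  move=> z; rewrite /race/= !in_itv/= !andbT.
  by case: ltP => zz; rewrite ?adde0 ?add0e !subrKC.
have mch (K : R -> \bar R) : measurable_fun [set: mR] K ->
    measurable_fun [set: mR * mR] (fun z : R * R => (\1_C z.2 : R)%:E * K z.1)%E.
  move=> mK; apply: emeasurable_funM; last exact: (measurableT_comp mK m1).
  by apply/measurable_EFinP; exact: (measurableT_comp mC' m2).
have ch0 (K : R -> \bar R) z : (forall d, 0 <= K d)%E -> (0 <= (\1_C z.2 : R)%:E * K z.1)%E.
  by move=> K0; rewrite mule_ge0.
have intC (E : probability mR R) (K : R -> \bar R) : measurable_fun [set: mR] K ->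
    (forall d, 0 <= K d)%E ->
    (\int[E \x E1]_z ((\1_C z.2 : R)%:E * K z.1) = E1 C * \int[E]_d K d)%E.
  move=> mK K0; rewrite (fubini_tonelli1 _ (mch K mK) (fun z => ch0 K z K0)).
  rewrite -ge0_integralZl//.
  apply: eq_integral => d _; rewrite /fubini_F/= ge0_integralZr//; last by apply/measurable_EFinP.
  by rewrite integral_indic// setIT.
have mS1 : measurable_fun [set: (mR * mR) * mR] (fun z : (R * R) * R => (\1_S z : R)%:E).
  exact: (measurable_EFinP _ _).2 (measurable_indic mS).
have S0 (z : (R * R) * R) : (0 <= (\1_S z : R)%:E)%E by rewrite lee_fin.
pose E2 : probability (mR * mR)%type R := (Ea \x Eb)%E.
have H := fubini_tonelli1 (m1 := E2) (m2 := E1) _ mS1 S0.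
rewrite integral_indic// setIT in H.
rewrite [LHS]H /E2 /=.
rewrite (integral_race_split (f1 := fun z => ((\1_C z.2 : R)%:E * K1 z.1)%E)
    (f2 := fun z => ((\1_C z.2 : R)%:E * K2 z.1)%E) a0 b0 ab eEa eEb eE1)//;
  [|exact: mch|exact: mch|by move=> z; exact: ch0|by move=> z; exact: ch0|].
  rewrite !intC//.
  have : (0 <= \int[Ea]_d K1 d)%E by apply: integral_ge0.
  have : (0 <= \int[Eb]_d K2 d)%E by apply: integral_ge0.
  move: (\int[Eb]_d _)%E (\int[Ea]_d _)%E => k2 k1 k20' k10'.
  have [a0' b0'] : (0 <= a%:E)%E /\ (0 <= b%:E)%E by rewrite !lee_fin !ltW.
  rewrite [RHS]muleC ge0_muleDr ?mule_ge0//.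
  by rewrite (muleCA (E1 C)) (muleCA (E1 C) a%:E).
move=> z; rewrite /race/= !in_itv/= !andbT.
have SE w : \1_S (z, w) = \1_A (w + Num.max (z.1 - z.2) 0) *
    \1_B (w + Num.max (z.2 - z.1) 0) * \1_C (Num.min z.1 z.2) :> R.
  case: (pselect (S (z, w))) => [Sz|nS].
    have [/= Az Bz Cz] := Sz.
    by rewrite (indE _ _ Az) (indE _ _ Bz) (indE _ _ Cz) !mulr1 indicE mem_set.
  rewrite [LHS]indicE memNset//; apply/esym; rewrite !indicE -!natrM !mulnb; apply/eqP.
  rewrite pnatr_eq0 eqb0; apply/negP => /andP[/andP[]]; rewrite !inE => Az Bz Cz.
  exact: nS.
rewrite /fubini_F; under eq_integral do rewrite SE.
case: ltP => zz; rewrite ?adde0 ?add0e.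
  have e1 : Num.max (z.1 - z.2) 0 = z.1 - z.2 by apply/max_idPl; rewrite subr_ge0 ltW.
  have e2 : Num.max (z.2 - z.1) 0 = 0 by apply/max_idPr; rewrite subr_le0 ltW.
  under eq_integral do rewrite e1 e2 addr0 EFinM muleC.
  rewrite ge0_integralZl ?lee_fin//.
  exact: (measurable_fun_pair2 (z.1 - z.2) mk1).
have e1 : Num.max (z.1 - z.2) 0 = 0 by apply/max_idPr; rewrite subr_le0.
have e2 : Num.max (z.2 - z.1) 0 = z.2 - z.1 by apply/max_idPl; rewrite subr_ge0.
under eq_integral do rewrite e1 e2 addr0 EFinM muleC.
rewrite ge0_integralZl ?lee_fin//.
exact: (measurable_fun_pair2 (z.2 - z.1) mk2).
Qed.

End race.

(** * Joint laws, and flips of an independent family *)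

Section product_law.
Context (R : realType).

Lemma product_measure_scale d1 d2 (T1 : measurableType d1) (T2 : measurableType d2)
    (p1 : probability T1 R) (p2 : probability T2 R)
    (nu : {measure set (T1 * T2) -> \bar R}) (c : {nonneg R}) :
  (forall A B, measurable A -> measurable B ->
     nu (A `*` B) = c%:num%:E * (p1 A * p2 B))%E ->
  forall S, measurable S -> (nu S = c%:num%:E * (p1 \x p2) S)%E.
Proof.
move=> nuE S mS.
rewrite -(@product_measure_unique _ _ _ _ R (mscale c p1) p2 nu)//; last first.
  by move=> A B mA mB; rewrite nuE// muleA.
apply: (@product_measure_unique _ _ _ _ R (mscale c p1) p2 (mscale c (p1 \x p2)%E)) => //.
by move=> A B mA mB; rewrite /mscale -muleA; congr (_ * _)%E; exact: product_measure1E.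
Qed.

Context d (T : measurableType d) (P : probability T R).
Notation mR := (measurableTypeR R).

(** The event [E] carries what is known of the other variables of a family: restricting [P] to [E]
    gives a finite measure, and uniqueness of product measures up to the factor [c] extends the
    formula from rectangles to all measurable sets. *)
Lemma joint_law d1 d2 (T1 : measurableType d1) (T2 : measurableType d2)
    (U : T -> T1) (V : T -> T2) (p : probability T1 R) (q : probability T2 R)
    (E : set T) (c : R) :
  measurable_fun [set: T] U -> measurable_fun [set: T] V ->
  measurable E -> 0 <= c ->
  (forall A B, measurable A -> measurable B ->
     P (E `&` U @^-1` A `&` V @^-1` B) = c%:E * (p A * q B))%E ->
  forall S : set (T1 * T2), measurable S ->
  (P (E `&` (fun t => (U t, V t)) @^-1` S) = c%:E * (p \x q) S)%E.
Proof.
move=> mU mV mE c0 H S mS.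
have mUV : measurable_fun [set: T] (fun t => (U t, V t)).
  exact: measurable_fun_pair.
pose nu : {measure set (T1 * T2)%type -> \bar R} :=
  measure_function_pushforward__canonical__measure_function_Measure (mrestr P mE) mUV.
have := @product_measure_scale _ _ _ _ p q nu (NngNum c0) _ S mS.
rewrite /nu/= /pushforward/= /mrestr setIC; apply.
by move=> A B mA mB; rewrite -H// -setIA setIC.
Qed.

(** The marginals [m] are part of the notion, since they are what the flips preserve. The variables
    are plain functions, so transformed families need no bundling. *)
Definition independent_with (I : eqType) (X : I -> T -> R)
    (m : I -> probability mR R) : Prop :=
  (forall i, measurable_fun [set: T] (X i : T -> mR)) /\
  forall (s : seq I) (A : I -> set R), uniq s ->
    (forall i, measurable (A i : set mR)) ->
    P (\bigcap_(i in [set` s]) (X i @^-1` A i)) = (\prod_(i <- s) m i (A i))%E.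

Lemma bigcap_seq_cons (I : eqType) (U : Type) (i : I) (s : seq I) (F : I -> set U) :
  \bigcap_(k in [set` i :: s]) F k = F i `&` \bigcap_(k in [set` s]) F k.
Proof.
rewrite predeqE => t; split=> [H|[H1 H2] k /=].
  by split=> [|k ks]; apply: H; rewrite /= inE ?eqxx// ks orbT.
by rewrite inE => /orP[/eqP ->//|]; exact: H2.
Qed.

(** In a unit cell, [x i] and [x j] are the increments of the passage time along the bottom and the
    left side, and [x k] is the weight of the top right corner. The slots [i] and [j] receive the
    increments along the top and the right side; [k] receives the dual weight, which completes the
    map to one that preserves the joint law. *)
Definition burke_flip (I : eqType) (i j k : I) (x : I -> R) (l : I) : R :=
  if l == i then x k + Num.max (x i - x j) 0
  else if l == j then x k + Num.max (x j - x i) 0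
  else if l == k then Num.min (x i) (x j)
  else x l.

Lemma measurable_rv (f : T -> R) (A : set R) :
  measurable_fun [set: T] (f : T -> mR) -> measurable (A : set mR) ->
  measurable (f @^-1` A).
Proof. by move=> mf mA; have := mf measurableT A mA; rewrite setTI. Qed.

(** The other coordinates are confined to a fixed event [E]. Independence on rectangles then gives
    the product law of the triple on [E], to which [burke_measure] applies. *)
Lemma burke_flip_independent (I : eqType) (i j k : I) (X : I -> T -> R)
    (m : I -> probability mR R) (a b : R) :
  i != j -> i != k -> j != k ->
  0 < a -> 0 < b -> a + b = 1 ->
  is_exp a (m i) -> is_exp b (m j) -> is_exp 1 (m k) ->
  independent_with X m ->
  independent_with (fun l t => burke_flip i j k (X^~ t) l) m.
Proof.
move=> ij ik jk a0 b0 ab ei ej ek [mX indX].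
split=> [l|s A us mA].
  have mmax u v : measurable_fun [set: T] (fun t => X k t + Num.max (X u t - X v t) 0 : R).
    apply: measurable_funD; first exact: mX.
    apply: measurable_maxr => //.
    by apply: measurable_funB; exact: mX.
  have mmin : measurable_fun [set: T] (fun t => Num.min (X i t) (X j t) : R).
    by apply: measurable_minr; exact: mX.
  rewrite /burke_flip; case: eqP => _; first exact: mmax.
  case: eqP => _; first exact: mmax.
  case: eqP => _; first exact: mmin.
  exact: mX.
pose X' l t := burke_flip i j k (X^~ t) l.
pose s0 := [seq l <- s | l \notin [:: i; j; k]].
(* Padding with the whole line outside [s] lets the list begin with [i], [j], [k]. *)
pose B l := if l \in s then A l else setT.
have mB l : measurable (B l : set mR) by rewrite /B; case: ifP.
have uijk : uniq [:: i; j; k] by rewrite /= !inE negb_or ij ik jk.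
have us1 : uniq ([:: i; j; k] ++ s0).
  rewrite cat_uniq uijk filter_uniq// andbT; apply/hasPn => l.
  by rewrite mem_filter => /andP[].
have sub l : l \in s -> l \in [:: i; j; k] ++ s0.
  by move=> ls; rewrite mem_cat mem_filter ls andbT orbN.
transitivity (P (\bigcap_(l in [set` [:: i; j; k] ++ s0]) (X' l @^-1` B l))).
  congr (P _); rewrite predeqE => t; split=> H l /= ls.
    by rewrite /B; case: ifPn => // /H.
  by have := H _ (sub _ ls); rewrite /= /B ls.
have -> : (\prod_(l <- s) m l (A l) = \prod_(l <- [:: i; j; k] ++ s0) m l (B l))%E.
  rewrite [RHS](bigID (mem s))/= [X in (_ * X)%E]big1 ?mule1; last first.
    by move=> l /negPf ls; rewrite /B ls probability_setT.
  rewrite -[RHS]big_filter [RHS](perm_big s).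
    by rewrite big_seq [RHS]big_seq; apply: eq_bigr => l ls; rewrite /B ls.
  apply: uniq_perm; rewrite ?filter_uniq// => l; rewrite mem_filter.
  by case: (boolP (l \in s)) => // /sub ->.
clearbody B => {A us mA sub}.
pose E := \bigcap_(l in [set` s0]) (X l @^-1` B l).
have mE : measurable E.
  apply: fin_bigcap_measurable => // l _.
  exact: measurable_rv.
have us0 : uniq s0 by move: us1; rewrite cat_uniq => /and3P[].
have EE : P E = (\prod_(l <- s0) m l (B l))%E by exact: indX.
have EijkE (C : I -> set R) : (forall l, measurable (C l : set mR)) ->
    (P (E `&` X i @^-1` C i `&` X j @^-1` C j `&` X k @^-1` C k) =
     P E * (m i (C i) * m j (C j) * m k (C k)))%E.
  move=> mC; pose C' l := if l \in [:: i; j; k] then C l else B l.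
  have mC' l : measurable (C' l : set mR) by rewrite /C'; case: ifP.
  have s0C l : l \in s0 -> C' l = B l.
    by rewrite mem_filter => /andP[/negPf lijk _]; rewrite /C' lijk.
  have := indX ([:: i; j; k] ++ s0) C' us1 mC'.
  rewrite !bigcap_seq_cons !big_cons.
  rewrite (_ : \bigcap_(_ in _) _ = E); last first.
    by apply: eq_bigcapr => l /= /s0C ->.
  rewrite (_ : (\prod_(l <- s0) _ = P E)%E); last first.
    by rewrite EE big_seq [RHS]big_seq; apply: eq_bigr => l /s0C ->.
  rewrite /C' !inE !eqxx !orbT /= => H.
  rewrite [RHS]muleC -!muleA -H; congr (P _).
  by rewrite predeqE => t; split => [[[[? ?] ?] ?]|[? [? [? ?]]]].
have fE : P E = (fine (P E))%:E by rewrite fineK// fin_num_measure.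
have PE0 : 0 <= fine (P E) by rewrite fine_ge0.
pose CC (A B C : set R) l := if l == i then A else if l == j then B else C.
(* First the pair [(X i, X j)], with [X k] and the others confined to events; [X k] is adjoined
   below by a second use of [joint_law]. *)
have law2 C S : measurable (C : set mR) -> measurable (S : set (mR * mR)) ->
    (P (E `&` (fun t => (X i t, X j t)) @^-1` S `&` X k @^-1` C) =
     P E * ((m i \x m j) S * m k C))%E.
  move=> mC mS.
  have mEC : measurable (E `&` X k @^-1` C).
    by apply: measurableI => //; exact: measurable_rv.
  have fC : (P E * m k C = (fine (P E * m k C))%:E)%E.
    by rewrite fineK// fin_numM// fin_num_measure.
  transitivity ((fine (P E * m k C))%:E * (m i \x m j) S)%E; last first.
    by rewrite -fC -muleA [in RHS](muleC _ (m k C)).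
  rewrite setIAC; apply: (joint_law (mX i) (mX j) mEC _ _ mS).
    by rewrite fine_ge0// mule_ge0.
  move=> A B' mA mB'; rewrite -fC.
  have := EijkE (CC A B' C); rewrite /CC !eqxx ![_ == i]eq_sym (negPf ij) (negPf ik).
  rewrite [k == j]eq_sym (negPf jk) => H.
  rewrite -muleA [(m k C * _)%E]muleC -H; last first.
    by move=> l; case: ifP => // _; case: ifP.
  congr (P _).
  by rewrite predeqE => t; split => [[[[? ?] ?] ?]|[[[? ?] ?] ?]].
rewrite !big_cons !bigcap_seq_cons -EE.
rewrite (_ : \bigcap_(_ in _) _ = E); last first.
  apply: eq_bigcapr => l /=; rewrite mem_filter !inE !negb_or => /andP[/and3P[li lj lk] _].
  by rewrite predeqE => t; rewrite /X' /burke_flip/= (negPf li) (negPf lj) (negPf lk).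
have := burke_measure a0 b0 ab ei ej ek (mB i) (mB j) (mB k).
set S := [set z | _] => SE.
have mS : measurable (S : set ((mR * mR) * mR)) by exact: measurable_burke.
transitivity (P (E `&` (fun t => ((X i t, X j t), X k t)) @^-1` S)).
  congr (P _); rewrite predeqE => t; rewrite /X' /burke_flip /= !eqxx.
  rewrite ![_ == i]eq_sym (negPf ij) (negPf ik) [k == j]eq_sym (negPf jk).
  by split => [[? [? [? ?]]]|[? [? ? ?]]].
apply: etrans (joint_law (p := (m i \x m j)%E) (q := m k) (c := fine (P E))
    (measurable_fun_pair (mX i) (mX j)) (mX k) mE _ _ mS) _ => //.
  by move=> S' C mS' mC; rewrite law2// -fE.
by rewrite SE -fE muleC !muleA.
Qed.

End product_law.

(** * Deviations of sums of independent exponentials *)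

Section chernoff.
Context (R : realType) d (T : measurableType d) (P : probability T R).
Notation mR := (measurableTypeR R).

Lemma measurable_expRM (c : R) : measurable_fun [set: mR] (fun x : R => expR (c * x)).
Proof. by apply: measurableT_comp => //; exact: measurable_funM. Qed.

(** The tilted density is [lam / (lam - c)] times the density of rate [lam - c]. *)
Lemma exp_mgf (lam c : R) (m : probability mR R) : 0 < lam -> c < lam ->
  is_exp lam m -> (\int[m]_x (expR (c * (x : R)))%:E = (lam / (lam - c))%:E)%E.
Proof.
move=> lam0 clam em.
have lc0 : 0 < lam - c by rewrite subr_gt0.
rewrite (integral_is_exp lam0 em (f := fun x : R => (expR (c * x))%:E)); last 2 first.
- exact: (measurable_EFinP _ _).2 (measurable_expRM c).
- by move=> x; rewrite lee_fin expR_ge0.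
transitivity (\int[@lebesgue_measure R]_x
    ((lam / (lam - c))%:E * (exponential_pdf (lam - c) x)%:E))%E.
  apply: eq_integral => x _; rewrite -!EFinM; congr EFin.
  have [x0|x0] := ltP x 0; first by rewrite !lt0_exponential_pdf// !mulr0.
  rewrite !exponential_pdfE// [RHS]mulrA divfK ?gt_eqF// mulrCA -expRD.
  by congr (_ * expR _); ring.
rewrite ge0_integralZl ?integral_exponential_pdf ?mule1//.
- by apply/measurable_EFinP; exact: measurable_exponential_pdf.
- by move=> x _; rewrite lee_fin exponential_pdf_ge0// ltW.
- by rewrite lee_fin divr_ge0 ?ltW.
Qed.

(** Independence is given for events only, so the induction on [s] keeps a list [s'] of coordinates
    confined to events. Moving [i] from [s] to [s'] with an arbitrary event [B], the induction
    hypothesis shows that the other factors, integrated over [X i] in [B], define a multiple of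
    [m i]. Integrating [f] against this measure restores the factor of [i]. *)
Lemma expectation_prod_independent (I : eqType) (X : I -> T -> R)
    (m : I -> probability mR R) (f : R -> R) (v : I -> R) (s s' : seq I) (A : I -> set R) :
  independent_with P X m ->
  measurable_fun [set: mR] f -> (forall x, 0 <= f x) ->
  (forall i, i \in s -> (\int[m i]_x (f (x : R))%:E = (v i)%:E)%E) ->
  uniq (s ++ s') -> (forall i, measurable (A i : set mR)) ->
  (\int[P]_(t in \bigcap_(i in [set` s']) X i @^-1` A i)
     (\prod_(i <- s) f (X i t))%:E =
   (\prod_(i <- s) v i)%:E * \prod_(i <- s') m i (A i))%E.
Proof.
move=> [mX indX] mf f0.
elim: s s' A => [|i s IH] s' A vE us mA.
  rewrite big_nil mul1e -indX//.
  under eq_integral do rewrite big_nil.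
  rewrite integral_cst ?mul1e//.
  apply: fin_bigcap_measurable => // l _; exact: measurable_rv.
have us' : uniq (s ++ i :: s').
  by rewrite (perm_uniq (_ : perm_eq _ ((i :: s) ++ s')))// (perm_catCA s [:: i] s').
have IHi := IH (i :: s') _ (fun j js => vE j (mem_behead (s := i :: s) js)) us'.
have v0 j : j \in i :: s -> 0 <= v j.
  move=> js; rewrite -lee_fin -vE//; apply: integral_ge0 => x _.
  by rewrite lee_fin.
have i_s' : i \notin s'.
  by move: us => /=; rewrite mem_cat negb_or => /andP[/andP[]].
pose E := \bigcap_(i in [set` s']) X i @^-1` A i.
have mE : measurable E.
  apply: fin_bigcap_measurable => // l _; exact: measurable_rv.
pose g t := \prod_(j <- s) f (X j t).
have mg : measurable_fun [set: T] g.
  by apply: measurable_prod => j _; exact: (measurableT_comp mf (mX j)).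
have g0 t : 0 <= g t by exact: prodr_ge0.
have mgE : measurable_fun [set: T] (fun t => g t * \1_E t).
  by apply: measurable_funM => //; exact: measurable_indic.
set K := (\prod_(j <- s') m j (A j))%E.
have K0 : (0 <= K)%E by apply: prode_ge0 => j _; exact: measure_ge0.
have Kfin : K \is a fin_num.
  rewrite /K; elim: (s') => [|j r IHr]; rewrite ?big_nil ?big_cons//.
  by rewrite fin_numM// fin_num_measure.
have pv0 : 0 <= \prod_(j <- s) v j.
  rewrite big_seq prodr_ge0// => j js; apply: v0; by rewrite inE js orbT.
pose k : {nonneg R} := NngNum (mulr_ge0 pv0 (fine_ge0 K0)).
have nuE (B : set R) : measurable (B : set mR) ->
    (mscale k (m i) B = \int[P]_(t in X i @^-1` B) (g t * \1_E t)%:E)%E.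
  move=> mB.
  pose A' j := if j == i then B else A j.
  have mA' j : measurable (A' j : set mR) by rewrite /A'; case: ifP.
  have := IHi A' mA'.
  have A'i : A' i = B by rewrite /A' eqxx.
  rewrite big_cons bigcap_seq_cons !A'i.
  rewrite (_ : \bigcap_(_ in _) _ = E); last first.
    apply: eq_bigcapr => j /= js; rewrite /A'; case: eqP => // ji.
    by move: i_s'; rewrite -ji js.
  rewrite (_ : (\prod_(j <- s') _ = K)%E); last first.
    rewrite /K big_seq [RHS]big_seq; apply: eq_bigr => j js; rewrite /A'.
    by case: eqP => // ji; move: i_s'; rewrite -ji js.
  rewrite integral_mkcondr.
  move=> H; rewrite /mscale/= EFinM fineK// -muleA [(K * _)%E]muleC -H.
  apply: eq_integral => t _; rewrite patchE indicE.
  by case: ifP; rewrite ?mulr1 ?mulr0.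
transitivity (\int[P]_t ((f (X i t))%:E * (g t * \1_E t)%:E))%E.
  rewrite integral_mkcond; apply: eq_integral => t _.
  by rewrite patchE big_cons indicE -EFinM; case: ifP => _; rewrite ?mulr1 ?mulr0.
have gE0 t : 0 <= g t * \1_E t by rewrite mulr_ge0.
have mfE : measurable_fun [set: mR] (fun x : R => (f x)%:E).
  exact: (measurable_EFinP _ _).2 mf.
have fE0 (x : R) : (0 <= (f x)%:E)%E by rewrite lee_fin.
rewrite -(integral_pushforward_density (mX i) mgE gE0 nuE mfE fE0).
rewrite ge0_integral_mscale//.
rewrite vE ?inE ?eqxx// big_cons /k/= !EFinM fineK//.
by rewrite muleC muleA.
Qed.

(** The inequality [1 + z <= expR z] at [z = y / (1 - y)]; what remains is
    [0 <= y ^+ 2 * (1 - 2 * y)]. *)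
Lemma invr_sub_le_expR (y : R) : `|y| <= 1 / 2 -> (1 - y)^-1 <= expR (y + 2 * y ^+ 2).
Proof.
rewrite ler_norml => /andP[y1 y2].
have y0 : 0 < 1 - y by lra.
have := expR_ge1Dx (y / (1 - y)).
have -> : 1 + y / (1 - y) = (1 - y)^-1 by field; lra.
move=> /le_trans; apply; rewrite ler_expR ler_pdivrMr//.
have : 0 <= y ^+ 2 * (1 - 2 * y) by rewrite mulr_ge0 ?sqr_ge0//; lra.
nra.
Qed.

(** Markov's inequality for [expR (c * S)], where [S] is the sum. The sign of [c] is free, so both
    tails are covered. *)
Lemma exponential_sum_tail (I : eqType) (X : I -> T -> R)
    (m : I -> probability mR R) (lam c y : R) (s : seq I) :
  independent_with P X m -> (forall i, i \in s -> is_exp lam (m i)) ->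
  uniq s -> 0 < lam -> `|c / lam| <= 1 / 2 ->
  (P [set t | (y <= c * \sum_(i <- s) X i t)%R] <=
   (expR (- y + (size s)%:R * (c / lam + 2 * (c / lam) ^+ 2)))%:E)%E.
Proof.
move=> indX es us lam0 clam.
have clt : c < lam.
  move: clam; rewrite ler_norml => /andP[_].
  by rewrite ler_pdivrMr//; lra.
have mf := measurable_expRM c.
have H := expectation_prod_independent (v := fun=> lam / (lam - c)) (s' := [::])
  (A := fun=> setT) indX mf (fun x => expR_ge0 _)
  (fun i is_ => exp_mgf lam0 clt (es i is_)).
rewrite cats0 in H; have {H} := H us (fun=> measurableT).
rewrite (_ : \bigcap_(_ in _) _ = setT); last by rewrite predeqE => t; split.
rewrite big_nil mule1 big_const_seq count_predT iter_mulr_1 => H.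
have mS : measurable_fun [set: T] (fun t => c * \sum_(i <- s) X i t).
  apply: measurable_funM => //; apply: measurable_sum => i; exact: indX.1.
have mA : measurable [set t | (y <= c * \sum_(i <- s) X i t)%R].
  rewrite (_ : [set t | _] = (fun t => c * \sum_(i <- s) X i t) @^-1` `[y, +oo[%classic).
    exact: measurable_rv.
  by rewrite predeqE => t; rewrite /= in_itv/= andbT.
set A := [set t | _].
have prodE t : \prod_(i <- s) expR (c * X i t) = expR (c * \sum_(i <- s) X i t).
  by rewrite mulr_sumr expR_sum.
have mexp : measurable_fun [set: T] (fun t => (expR (c * \sum_(i <- s) X i t))%:E).
  apply/measurable_EFinP; exact: measurableT_comp.
apply: (@le_trans _ _ (\int[P]_t ((expR (- y))%:E * (expR (c * \sum_(i <- s) X i t))%:E))%E).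
  have -> : (P A = \int[P]_t (\1_A t)%:E)%E by rewrite integral_indic ?setIT.
  apply: ge0_le_integral => //.
  - by apply/measurable_EFinP; exact: measurable_indic.
  - exact: measurable_funeM.
  - move=> t _; rewrite -EFinM lee_fin -expRD indicE.
    case: (boolP (t \in A)) => [|_]; last exact: expR_ge0.
    by rewrite inE /A/= => h; rewrite -expR0 ler_expR; lra.
rewrite ge0_integralZl ?lee_fin ?expR_ge0//.
under eq_integral do rewrite -prodE.
rewrite H -EFinM lee_fin expRD ler_wpM2l ?expR_ge0//.
rewrite [X in expR X]mulrC expRM_natr lerXn2r ?nnegrE ?expR_ge0 ?divr_ge0 ?subr_ge0 ?(ltW lam0) ?(ltW clt)//.
have -> : lam / (lam - c) = (1 - c / lam)^-1 by field; lra.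
exact: invr_sub_le_expR.
Qed.

(** The bound depends on the rate only through [lam0] and on the number of terms only through [N],
    which makes it uniform over the family of a later union bound. *)
Lemma exponential_sum_deviation (I : eqType) (X : I -> T -> R)
    (m : I -> probability mR R) (lam lam0 delta N : R) (s : seq I) :
  independent_with P X m -> (forall i, i \in s -> is_exp lam (m i)) ->
  uniq s -> 0 < lam0 -> lam0 <= lam -> lam0 <= 1 -> 0 < delta -> delta <= 1 ->
  (size s)%:R <= N ->
  (P [set t | (delta * N < `|(\sum_(i <- s) X i t) - (size s)%:R / lam|)%R] <=
   (2 * expR (- (delta ^+ 2 * lam0 ^+ 2 / 8 * N)))%:E)%E.
Proof.
move=> indX es us lam00 lam0l lam01 d0 d1 sN.
have l0 : 0 < lam by exact: lt_le_trans lam0l.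
have N0 : 0 <= N by exact: le_trans sN.
(* Since [c / lam <= delta * lam0 / 4], the quadratic term is at most
   [delta ^+ 2 * lam0 ^+ 2 / 8 * N], half of the linear gain [c * delta * N]. *)
pose c := delta * lam0 ^+ 2 / 4.
set k : R := (size s)%:R in sN *.
have c0 : 0 < c by rewrite /c divr_gt0// mulr_gt0// exprn_gt0.
have cl1 : c / lam <= delta * lam0 / 4.
  rewrite ler_pdivrMr// /c.
  have : 0 <= delta * lam0 * (lam - lam0) by rewrite mulr_ge0 ?subr_ge0// mulr_ge0// ltW.
  by lra.
have cl0 : 0 <= c / lam by rewrite divr_ge0 ?ltW.
have clh : `|c / lam| <= 1 / 2.
  have dl : delta * lam0 <= 1 by apply: mulr_ile1 => //; exact: ltW.
  by rewrite ger0_norm//; lra.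
have bound : - (c * (k / lam + delta * N)) + k * (c / lam + 2 * (c / lam) ^+ 2) <=
    - (delta ^+ 2 * lam0 ^+ 2 / 8 * N).
  have h1 : (c / lam) ^+ 2 <= (delta * lam0 / 4) ^+ 2.
    by rewrite lerXn2r ?nnegrE// divr_ge0// mulr_ge0 ?ltW.
  have h2 : k * (c / lam) ^+ 2 <= N * (delta * lam0 / 4) ^+ 2.
    by apply: ler_pM => //; rewrite ?sqr_ge0// /k.
  have -> : - (c * (k / lam + delta * N)) + k * (c / lam + 2 * (c / lam) ^+ 2) =
     2 * (k * (c / lam) ^+ 2) - c * delta * N by field; lra.
  by move: (k * (c / lam) ^+ 2) h2 => z h2; rewrite /c; lra.
have T1 := exponential_sum_tail (c * (k / lam + delta * N)) indX es us l0 clh.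
have clh' : `|(- c) / lam| <= 1 / 2 by rewrite mulNr normrN.
have T2 := exponential_sum_tail (- c * (k / lam - delta * N)) indX es us l0 clh'.
have meas (e y : R) : measurable [set t | (y <= e * \sum_(i <- s) X i t)%R].
  rewrite (_ : [set t | _] = (fun t => e * \sum_(i <- s) X i t) @^-1` `[y, +oo[%classic).
    apply: measurable_rv; last exact: measurable_itv.
    by apply: measurable_funM => //; apply: measurable_sum => i; exact: indX.1.
  by rewrite predeqE => t; rewrite /= in_itv/= andbT.
have measD : measurable [set t | (delta * N < `|(\sum_(i <- s) X i t) - k / lam|)%R].
  rewrite (_ : [set t | _] = (fun t => `|(\sum_(i <- s) X i t) - k / lam|) @^-1` `]delta * N, +oo[%classic).
    apply: measurable_rv; last exact: measurable_itv.
    apply: measurableT_comp => //; apply: measurable_funB => //.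
    by apply: measurable_sum => i; exact: indX.1.
  by rewrite predeqE => t; rewrite /= in_itv/= andbT.
apply: (@le_trans _ _ (P ([set t | (c * (k / lam + delta * N) <= c * \sum_(i <- s) X i t)%R] `|`
    [set t | (- c * (k / lam - delta * N) <= - c * \sum_(i <- s) X i t)%R]))).
  apply: le_measure; rewrite ?inE//; first exact: measurableU.
  move=> t /=; rewrite lter_normr => /orP[h|h].
    by left; rewrite ler_pM2l//; lra.
  by right; rewrite ler_nM2l ?oppr_lt0//; lra.
apply: (le_trans (measureU2 _ _ _)) => //.
rewrite mulr_natl mulr2n EFinD; apply: leeD.
  by apply: (le_trans T1); rewrite lee_fin ler_expR.
apply: (le_trans T2); rewrite lee_fin ler_expR.
by apply: le_trans bound; rewrite (mulNr c lam^-1) sqrrN; lra.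
Qed.

End chernoff.

(** * Lattice paths and last-passage times *)

Definition site_le (x y : site) : bool := (x.1 <= y.1) && (x.2 <= y.2).

Lemma site_le_refl x : site_le x x.
Proof. by rewrite /site_le !lexx. Qed.

Lemma site_le_trans y x z : site_le x y -> site_le y z -> site_le x z.
Proof.
by move=> /andP[a b] /andP[c e]; rewrite /site_le (le_trans a c) (le_trans b e).
Qed.

Definition site_shift (z : site) (i j : nat) : site := (z.1 + i%:Z, z.2 + j%:Z).

Lemma up_right_stepP (x y : site) :
  reflect (y = site_shift x 1 0 \/ y = site_shift x 0 1) (up_right_step x y).
Proof.
case: x y => [a b] [c e]; rewrite /up_right_step /site_shift /=.
apply: (iffP orP) => -[].
- by rewrite /GRing.add/= => /eqP[h1 h2]; left; congr (_, _); lia.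
- by rewrite /GRing.add/= => /eqP[h1 h2]; right; congr (_, _); lia.
- by move=> [-> ->]; left; apply/eqP; congr (_, _); rewrite /=; lia.
- by move=> [-> ->]; right; apply/eqP; congr (_, _); rewrite /=; lia.
Qed.

Lemma up_right_path_last (x : site) p : path up_right_step x p ->
  site_le x (last x p) /\
  (last x p).1 + (last x p).2 = x.1 + x.2 + (size p)%:Z.
Proof.
elim: p x => [|y p IH] x /=; first by rewrite site_le_refl addr0.
case/andP => /up_right_stepP xy /IH[h1 h2].
split; last by case: xy h2 => -> /= ->; lia.
by apply: site_le_trans h1; case: xy => ->; rewrite /site_le /=; lia.
Qed.

(** An explicit finite list: maxima over it are attained, and geodesics depend on finitely many
    comparisons of weights. *)
Fixpoint paths_from (n : nat) (x : site) : seq (seq site) :=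
  if n is n'.+1 then
    [seq site_shift x 1 0 :: p | p <- paths_from n' (site_shift x 1 0)] ++
    [seq site_shift x 0 1 :: p | p <- paths_from n' (site_shift x 0 1)]
  else [:: [::]].

Lemma mem_paths_from n x p :
  (p \in paths_from n x) = path up_right_step x p && (size p == n).
Proof.
elim: n x p => [|n IH] x [|y p] //=.
- by rewrite inE andbF.
- by rewrite mem_cat; apply/negP => /orP[] /mapP[].
rewrite mem_cat eqSS; apply/orP/idP.
  by case=> /mapP[q]; rewrite IH => /andP[h1 h2] [-> ->]; rewrite h1 h2 !andbT;
    apply/up_right_stepP; [left|right].
case/andP => /andP[/up_right_stepP[] yE yp] sp; [left|right]; rewrite yE in yp *;
  by apply/map_f; rewrite IH yp sp.
Qed.

Lemma norm1ZB (x y : site) : norm1Z (y - x) = (`|y.1 - x.1| + `|y.2 - x.2|)%N.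
Proof. by []. Qed.

Lemma up_right_paths_size x y p : up_right_paths x y p -> size p = norm1Z (y - x).
Proof.
case=> /up_right_path_last[] + + py; rewrite py => /andP[h1 h2] h3.
by rewrite norm1ZB; lia.
Qed.

Lemma up_right_paths_exist x y : site_le x y -> exists p, up_right_paths x y p.
Proof.
move=> xy.
suff H n z : site_le z y -> (`|y.1 - z.1| + `|y.2 - z.2| = n)%N ->
    exists p, up_right_paths z y p by exact: (H _ x).
elim: n z => [|n IH] z /andP[h1 h2] zn.
  exists [::]; split => //=.
  by rewrite [LHS]surjective_pairing [RHS]surjective_pairing; congr (_, _); lia.
have [e1|e1] := eqVneq y.1 z.1.
  have [||p [pp pl]] := IH (site_shift z 0 1); rewrite /site_le /site_shift/=; try lia.
  exists (site_shift z 0 1 :: p); split => //=; rewrite pp andbT.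
  by apply/up_right_stepP; right.
have [||p [pp pl]] := IH (site_shift z 1 0); rewrite /site_le /site_shift/=; try lia.
exists (site_shift z 1 0 :: p); split => //=; rewrite pp andbT.
by apply/up_right_stepP; left.
Qed.

Lemma seq_argmax d (R : orderType d) (U : eqType) (f : U -> R) (s : seq U) :
  s != [::] -> exists2 p, p \in s & forall q, q \in s -> (f q <= f p)%O.
Proof.
elim: s => // a [_ _|b r IH _].
  by exists a; rewrite ?inE// => q; rewrite inE => /eqP ->.
have [//|p pr pm] := IH.
have [ap|pa] := leP (f a) (f p).
  exists p; first by rewrite inE pr orbT.
  by move=> q; rewrite inE => /orP[/eqP ->//|/pm].
exists a; first by rewrite inE eqxx.
move=> q; rewrite inE => /orP[/eqP ->//|/pm qp].
exact: le_trans (ltW pa).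
Qed.

Lemma last_take (U : Type) (x : U) (p : seq U) (i : nat) : (i <= size p)%N ->
  last x (take i p) = nth x (x :: p) i.
Proof.
elim: p x i => [|y p IH] x [|i] //= ip.
by rewrite IH//; exact: set_nth_default.
Qed.

Section last_passage_theory.
Context (R : realType).
Implicit Types (w : site -> R) (x y z : site).

Definition lattice_paths x y : seq (seq site) :=
  [seq p <- paths_from (norm1Z (y - x)) x | last x p == y].

Lemma mem_lattice_paths x y p : p \in lattice_paths x y <-> up_right_paths x y p.
Proof.
rewrite mem_filter mem_paths_from; split.
  by move=> /andP[/eqP lp /andP[pp _]].
move=> H; have := up_right_paths_size H; case: H => pp lp sp.
by rewrite lp eqxx pp sp eqxx.
Qed.

Lemma up_right_paths_argmax w x y : site_le x y ->
  exists2 p, up_right_paths x y p &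
    forall q, up_right_paths x y q -> path_weight w x q <= path_weight w x p.
Proof.
move=> xy.
have [p0 /mem_lattice_paths p0s] := up_right_paths_exist xy.
have [|p ps pm] := seq_argmax (path_weight w x) (s := lattice_paths x y).
  by apply: contraTneq p0s => ->.
exists p; first exact/mem_lattice_paths.
by move=> q /mem_lattice_paths /pm.
Qed.

(** The supremum disappears: maximality becomes a matter of comparing path weights, the form in
    which measurability is proved later. *)
Lemma last_passageP w x y p : site_le x y ->
  maximizing_paths w x y p <-> up_right_paths x y p /\
    forall q, up_right_paths x y q -> path_weight w x q <= path_weight w x p.
Proof.
move=> xy.
have [p0 p0p p0m] := up_right_paths_argmax w xy.
have lpE : last_passage w x y = path_weight w x p0.
  apply/eqP; rewrite eq_le; apply/andP; split.
    by apply: ge_sup; [exists (path_weight w x p0), p0|move=> _ [q /p0m ? <-]].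
  apply: ub_le_sup; last by exists p0.
  by exists (path_weight w x p0) => _ [q /p0m ? <-].
rewrite /maximizing_paths /= lpE; split => -[pp].
  by move=> -> ; split.
by move=> pm; split=> //; apply/eqP; rewrite eq_le p0m ?pm.
Qed.

Lemma last_passage_attained w x y : site_le x y ->
  exists2 p, up_right_paths x y p & path_weight w x p = last_passage w x y.
Proof.
move=> xy; have [p pp pm] := up_right_paths_argmax w xy.
by exists p => //; apply: ((last_passageP w p xy).2 (conj pp pm)).2.
Qed.

Lemma last_passage_ge w x y p : site_le x y -> up_right_paths x y p ->
  path_weight w x p <= last_passage w x y.
Proof.
move=> xy; have [p0 p0p p0E] := last_passage_attained w xy.
have [_ p0m] := (last_passageP w p0 xy).1 (conj p0p p0E).
by rewrite -p0E => /p0m.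
Qed.

(** The junction site belongs to both pieces; this is the origin of the correction terms in the
    inequalities for [last_passage]. *)
Lemma path_weight_cat w x p1 p2 :
  path_weight w x (p1 ++ p2) + w (last x p1) =
  path_weight w x p1 + path_weight w (last x p1) p2.
Proof.
have E : path_weight w (last x p1) p2 = w (last x p1) + \sum_(z <- p2) w z.
  by rewrite /path_weight big_cons.
by rewrite E /path_weight -cat_cons big_cat /=; ring.
Qed.

Lemma last_passage_concat w x y z : site_le x y -> site_le y z ->
  last_passage w x y + last_passage w y z <= last_passage w x z + w y.
Proof.
move=> xy yz.
have [p1 [pp1 pl1] <-] := last_passage_attained w xy.
have [p2 [pp2 pl2] <-] := last_passage_attained w yz.
rewrite -[in X in _ + X]pl1 -path_weight_cat pl1 lerD2r.
apply: last_passage_ge; first exact: site_le_trans yz.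
by split; rewrite ?cat_path ?pp1 ?last_cat pl1.
Qed.

Lemma last_passage_refl w x : w x <= last_passage w x x.
Proof.
have := last_passage_ge w (site_le_refl x) (p := [::]).
by rewrite /path_weight big_seq1; apply.
Qed.

Lemma last_passage_step w x y z : site_le x y -> up_right_step y z ->
  last_passage w x y + w z <= last_passage w x z.
Proof.
move=> xy yz.
have yz' : site_le y z.
  by case/up_right_stepP: yz => ->; rewrite /site_le/=; lia.
have := last_passage_ge w yz' (p := [:: z]).
rewrite /path_weight big_cons big_seq1 => H.
have {H} := H (conj _ erefl); rewrite /= yz => /(_ isT).
have := last_passage_concat w xy yz'; lra.
Qed.

Lemma last_passage_ge_start w x y : (forall v, 0 <= w v) ->
  site_le x y -> w x <= last_passage w x y.
Proof.
move=> w0 xy; have [p _ <-] := last_passage_attained w xy.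
by rewrite /path_weight big_cons lerDl sumr_ge0.
Qed.

(** Verification principle: a function that gains at least the weight of the new site at every step
    of the rectangle dominates every path, by summation along it. *)
Lemma last_passage_le w x y (H : site -> R) : site_le x y -> w x <= H x ->
  (forall u v, site_le x u -> up_right_step u v -> site_le v y ->
     H u + w v <= H v) ->
  last_passage w x y <= H y.
Proof.
move=> xy Hx Hs; have [p [pp pl] <-] := last_passage_attained w xy.
suff {xy Hx} : forall u, site_le x u -> path up_right_step u p -> last u p = y ->
    H u + \sum_(z <- p) w z <= H y.
  by move=> /(_ x (site_le_refl x) pp pl); rewrite /path_weight big_cons; lra.
elim: p {pp pl} => [|v p IH] u xu /=; first by rewrite big_nil addr0 => _ ->.
case/andP => uv vp vl.
have [vy _] := up_right_path_last vp; rewrite vl in vy.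
have xv : site_le x v.
  apply: site_le_trans xu _.
  by case/up_right_stepP: uv => ->; rewrite /site_le/=; lia.
have := IH v xv vp vl; have := Hs u v xu uv vy; rewrite big_cons; lra.
Qed.

Lemma geodesic_split w x y i : site_le x y -> (i <= norm1Z (y - x)%R)%N ->
  let z := nth x (geodesic w x y) i in
  [/\ site_le x z, site_le z y, norm1Z (z - x) = i &
   last_passage w x y + w z <= last_passage w x z + last_passage w z y].
Proof.
move=> xy iN; rewrite /geodesic.
have [p0 p0p p0E] := last_passage_attained w xy.
(* A maximizer exists, so [xget] does not fall back on its default [[::]]. *)
have : maximizing_paths w x y (xget [::] (maximizing_paths w x y)).
  by apply: (@xgetPex _ [::]); exists p0.
move: (xget _ _) => p pmax; have [pp pE] := pmax.
have psz := up_right_paths_size pp.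
have [ppath plast] := pp.
pose p1 := take i p; pose p2 := drop i p.
have zE : nth x (x :: p) i = last x p1.
  by rewrite /p1 last_take ?psz.
rewrite zE /=.
have : path up_right_step x (p1 ++ p2) by rewrite cat_take_drop.
rewrite cat_path => /andP[pp1 pp2].
have l2 : last (last x p1) p2 = y by rewrite -last_cat cat_take_drop.
have [xz _] := up_right_path_last pp1.
have [] := up_right_path_last pp2; rewrite l2 => zy _.
split => //.
  rewrite -(up_right_paths_size (conj pp1 erefl)) size_take psz.
  by case: ltnP => // h; apply/eqP; rewrite eqn_leq iN h.
rewrite -pE -(cat_take_drop i p) path_weight_cat.
by apply: lerD; apply: last_passage_ge.
Qed.

End last_passage_theory.

(** * Stationary last-passage percolation *)

Section stationary.
Context (R : realType).
Implicit Types (x : nat * nat -> R) (i j k l p q : nat).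

(* The weights are transformed in place: after the flips of rows [1..j], the slot [(k, 0)]
   holds the horizontal increment at [(k, j)], while during row [j] the slot [(0, j)]
   carries the current vertical increment. *)
Fixpoint burke_row (j i : nat) x : nat * nat -> R :=
  if i is i'.+1 then burke_flip (i, 0%N) (0%N, j) (i, j) (burke_row j i' x) else x.

Fixpoint burke_rect (p j : nat) x : nat * nat -> R :=
  if j is j'.+1 then burke_row j p (burke_rect p j' x) else x.

(* Last-passage time from the origin in the quadrant with boundary weights, read off
   the left boundary column and the increments along row [j]. *)
Definition stationary_time p x i j : R :=
  \sum_(0 <= l < j.+1) x (0%N, l) + \sum_(1 <= k < i.+1) burke_rect p j x (k, 0%N).

Lemma burke_row_above j i x k l : l != 0%N -> l != j -> burke_row j i x (k, l) = x (k, l).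
Proof.
move=> l0 lj; elim: i => //= i IH; rewrite /burke_flip !xpair_eqE.
by rewrite (negPf l0) (negPf lj) !andbF.
Qed.

Lemma burke_row_right j i x k l : (i < k)%N -> burke_row j i x (k, l) = x (k, l).
Proof.
elim: i => //= i IH ik; rewrite /burke_flip !xpair_eqE.
have -> : (k == i.+1) = false by lia.
have -> : (k == 0%N) = false by lia.
by rewrite /= IH// ltnW.
Qed.

Lemma burke_row_done j i k x : (0 < j)%N -> (0 < k <= i)%N ->
  burke_row j i x (k, 0%N) = burke_row j k x (k, 0%N).
Proof.
move=> j0 /andP[k0]; elim: i => [|i IH]; first by lia.
rewrite leq_eqVlt => /orP[/eqP -> //|]; rewrite ltnS => ki.
rewrite /= /burke_flip !xpair_eqE.
have -> : (k == i.+1) = false by lia.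
have -> : (k == 0%N) = false by lia.
by rewrite /= IH.
Qed.

Lemma burke_rect_above p j x k l : (j < l)%N -> burke_rect p j x (k, l) = x (k, l).
Proof.
elim: j => //= j IH jl; rewrite burke_row_above ?IH ?(ltnW jl)//; lia.
Qed.

Lemma stationary_timeS p x i j :
  stationary_time p x i.+1 j = stationary_time p x i j + burke_rect p j x (i.+1, 0%N).
Proof. by rewrite /stationary_time [in LHS](big_nat_recr i.+1)//= addrA. Qed.

Lemma stationary_time0 p x j : stationary_time p x 0 j = \sum_(0 <= l < j.+1) x (0%N, l).
Proof. by rewrite /stationary_time [X in _ + X]big_geq ?addr0. Qed.

(** After [i] flips of row [j + 1] the slot [(0, j + 1)] holds the vertical increment at column [i].
    The two ways round a cell agree, because [V + (U - V)^+ = U + (V - U)^+]. *)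
Lemma stationary_time_vertical p x i j : (i <= p)%N ->
  stationary_time p x i j.+1 =
  stationary_time p x i j + burke_row j.+1 i (burke_rect p j x) (0%N, j.+1).
Proof.
elim: i => [_|i IH ip].
  rewrite !stationary_time0 [LHS]big_nat_recr//=; congr (_ + _).
  by rewrite burke_rect_above.
rewrite !stationary_timeS IH 1?ltnW//.
rewrite [burke_rect p j.+1 x _]/= burke_row_done; [|by []|by lia].
set y := burke_rect p j x.
have R0 l := @burke_row_right j.+1 i y i.+1 l (ltnSn i).
rewrite /= /burke_flip !xpair_eqE !eqxx /= !R0.
set a := y (_, j.+1); set b := burke_row _ _ _ _.
by case: (lerP (y (i.+1, 0%N) - b) 0); case: (lerP (b - y (i.+1, 0%N)) 0); lra.
Qed.

(** Identifies [stationary_time], defined by sums of increments, with a last-passage time. On one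
    cell it is the identity [V + (U - V)^+ = max(U, V)]. *)
Lemma stationary_time_rec p x i j : (i < p)%N ->
  stationary_time p x i.+1 j.+1 = x (i.+1, j.+1) +
    Num.max (stationary_time p x i j.+1) (stationary_time p x i.+1 j).
Proof.
move=> ip; have V := stationary_time_vertical x j (ltnW ip).
rewrite !stationary_timeS.
rewrite [burke_rect p j.+1 x _]/= burke_row_done; [|by []|by lia].
set y := burke_rect p j x in V *.
have R0 l := @burke_row_right j.+1 i y i.+1 l (ltnSn i).
rewrite /= /burke_flip !eqxx !R0.
rewrite [y (i.+1, j.+1)]burke_rect_above//.
rewrite V; set b := burke_row _ _ _ _ in V *; set s := stationary_time p x i j in V *.
by case: (lerP (y (i.+1, 0%N) - b) 0); case: (lerP (s + b) (s + y (i.+1, 0%N))); lra.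
Qed.

Context (w : site -> R) (z : site) (x : nat * nat -> R).
Hypothesis xw : forall i j, x (i.+1, j.+1) = w (site_shift z i.+1 j.+1).
Let G := last_passage w.

Lemma site_shift_le i j i' j' : (i <= i')%N -> (j <= j')%N ->
  site_le (site_shift z i j) (site_shift z i' j').
Proof. by rewrite /site_le/=; lia. Qed.

Lemma site_shift_up i j : up_right_step (site_shift z i j) (site_shift z i j.+1).
Proof. by apply/up_right_stepP; right; rewrite /site_shift/=; congr (_, _); lia. Qed.

Lemma site_shift_right i j : up_right_step (site_shift z i j) (site_shift z i.+1 j).
Proof. by apply/up_right_stepP; left; rewrite /site_shift/=; congr (_, _); lia. Qed.

(** The recursion followed backwards locates the point where a stationary geodesic leaves the axes:
    [(k, 0)] in the first case, [(0, l)] in the second. The induction starts where the predecessor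
    chosen by the maximum lies on an axis. *)
Lemma stationary_time_exit p i j : (0 < i <= p)%N -> (0 < j)%N ->
  (exists2 k, (0 < k <= i)%N & stationary_time p x i j <=
     stationary_time p x k 0 + G (site_shift z k 1) (site_shift z i j)) \/
  (exists2 l, (0 < l <= j)%N & stationary_time p x i j <=
     stationary_time p x 0 l + G (site_shift z 1 l) (site_shift z i j)).
Proof.
elim: i j => // i IHi; elim=> // j IHj ip _.
rewrite stationary_time_rec; last by lia.
rewrite xw.
have step u v v' : site_le u v -> up_right_step v v' -> G u v + w v' <= G u v'.
  exact: last_passage_step.
case: (leP (stationary_time p x i j.+1)) => _.
- case: j IHj => [_|j IHj].
    left; exists i.+1; first by lia.
    by rewrite addrC lerD2l last_passage_refl.
  have {IHj} := IHj ip isT; set s := stationary_time p x i.+1 j.+1.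
  case=> -[k kk H]; [left|right]; exists k; try lia.
    have hs : site_le (site_shift z k 1) (site_shift z i.+1 j.+1) by apply: site_shift_le; lia.
    by have := step _ _ _ hs (site_shift_up _ _); lra.
  have hs : site_le (site_shift z 1 k) (site_shift z i.+1 j.+1) by apply: site_shift_le; lia.
  by have := step _ _ _ hs (site_shift_up _ _); lra.
- case: i IHi ip {IHj} => [_|i IHi] ip.
    right; exists j.+1; first by lia.
    by rewrite addrC lerD2l last_passage_refl.
  have ip' : (0 < i.+1 <= p)%N by lia.
  have {IHi} := IHi j.+1 ip' isT; set s := stationary_time p x i.+1 j.+1.
  case=> -[k kk H]; [left|right]; exists k; try lia.
    have hs : site_le (site_shift z k 1) (site_shift z i.+1 j.+1) by apply: site_shift_le; lia.
    by have := step _ _ _ hs (site_shift_right _ _); lra.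
  have hs : site_le (site_shift z 1 k) (site_shift z i.+1 j.+1) by apply: site_shift_le; lia.
  by have := step _ _ _ hs (site_shift_right _ _); lra.
Qed.

(** With boundary weights at least those of [w], the stationary time satisfies the step condition of
    [last_passage_le]. *)
Lemma last_passage_le_stationary p q :
  w (site_shift z 0 0) <= x (0%N, 0%N) ->
  (forall i, w (site_shift z i.+1 0) <= x (i.+1, 0%N)) ->
  (forall j, w (site_shift z 0 j.+1) <= x (0%N, j.+1)) ->
  G z (site_shift z p q) <= stationary_time p x p q.
Proof.
move=> x00 xi xj.
pose H (v : site) := stationary_time p x `|v.1 - z.1| `|v.2 - z.2|.
have HE i j : H (site_shift z i j) = stationary_time p x i j.
  by rewrite /H /site_shift /= !(addrC z.1, addrC z.2) !addrK.
have z0 : site_shift z 0 0 = z by rewrite /site_shift !addr0 -surjective_pairing.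
rewrite -HE; apply: last_passage_le.
- by rewrite -[X in site_le X _]z0 site_shift_le.
- by rewrite -[in X in _ <= X]z0 HE stationary_time0 big_nat1 -[z in w z]z0.
move=> u v zu uv vy.
have [i [j uE]] : exists i, exists j, u = site_shift z i j.
  exists `|u.1 - z.1|%N, `|u.2 - z.2|%N; rewrite [LHS]surjective_pairing.
  by case/andP: zu => h1 h2; rewrite /site_shift; congr (_, _); lia.
case/up_right_stepP: uv => vE.
  have vE' : v = site_shift z i.+1 j.
    by rewrite vE uE /site_shift /=; congr (_, _); lia.
  have ip : (i < p)%N by move: vy; rewrite vE' /site_le /=; lia.
  rewrite vE' uE !HE; case: j {uE vE vE'} => [|j].
    rewrite stationary_timeS lerD2l; exact: xi.
  by rewrite stationary_time_rec// addrC xw lerD2l le_max lexx.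
have vE' : v = site_shift z i j.+1.
  by rewrite vE uE /site_shift /=; congr (_, _); lia.
have ip : (i <= p)%N by move: vy; rewrite vE' /site_le /=; lia.
rewrite vE' uE !HE; case: i ip {uE vE vE'} => [|i] ip.
  rewrite !stationary_time0 [in leRHS]big_nat_recr//= lerD2l; exact: xj.
by rewrite [leRHS]stationary_time_rec// addrC xw lerD2l le_max lexx orbT.
Qed.

End stationary.

(** * Concentration of the stationary time *)

Section stationary_deviation.
Context (R : realType).
Notation mR := (measurableTypeR R).

Lemma exponential_prob_scale (u : R) (A : set R) : 0 < u -> measurable (A : set mR) ->
  exponential_prob 1 ((fun r => r / u) @^-1` A) = exponential_prob u A.
Proof.
move=> u0 mA.
pose sc : mR -> mR := fun r : R => r / u.
have msc : measurable_fun [set: mR] sc by exact: measurable_funM.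
pose nu : {measure set mR -> \bar R} :=
  measure_function_pushforward__canonical__measure_function_Measure
    (exponential_law ltr01) msc.
have ray (x : R) : sc @^-1` `]x, +oo[%classic = `]x * u, +oo[%classic.
  by rewrite predeqE => r; rewrite /sc /= !in_itv/= !andbT ltr_pdivlMr.
rewrite -[RHS]/(exponential_law u0 A) -[LHS]/(nu A).
apply: (measure_eq_ray _ _ mA) => x.
  by rewrite (le_lt_trans (probability_le1 _ _)) ?ltry//= ray.
apply: (etrans (_ : nu _ = exponential_law ltr01 `]x * u, +oo[%classic)).
  by rewrite /nu /= /pushforward ray.
have E1 := is_exp_exponential_law (ltr01 : (0 : R) < 1).
have Eu := is_exp_exponential_law u0.
have [x0|x0] := leP 0 x.
  apply: (etrans (is_exp_ray false ltr01 E1 (mulr_ge0 x0 (ltW u0)))).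
  apply: esym; apply: (etrans (is_exp_ray false u0 Eu x0)).
  by congr (expR _)%:E; ring.
have xu0 : x * u < 0 by rewrite pmulr_llt0.
apply: (etrans (is_exp_ray_lt0 false ltr01 E1 xu0)).
exact: esym (is_exp_ray_lt0 false u0 Eu x0).
Qed.

(** The first coordinate is tested first, so the corner has rate [1 - u] and belongs to the column;
    hence the [q + 1] terms of the column sums. *)
Definition boundary_rate (u : R) (ij : nat * nat) : R :=
  if ij.1 == 0%N then 1 - u else if ij.2 == 0%N then u else 1.

(** A coupling: the environments for all [u] and [z] are read off the same field. For [0 < u < 1]
    the rates are at most 1, so the division increases nonnegative weights. *)
Definition boundary_weight (u : R) (w : site -> R) (z : site) (ij : nat * nat) : R :=
  w (site_shift z ij.1 ij.2) / boundary_rate u ij.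

Lemma boundary_rate_gt0 u ij : 0 < u < 1 -> 0 < boundary_rate u ij.
Proof.
by rewrite /boundary_rate => /andP[u0 u1]; case: ifP; [lra|case: ifP => // _; lra].
Qed.

Context d (T : measurableType d) (P : probability T R).

Lemma boundary_weight_independent (omega : site -> {RV P >-> R}) (u : R) (z : site)
    (u01 : 0 < u < 1) :
  mutually_independent omega -> (forall v, has_exponential_law 1 (omega v)) ->
  independent_with P (fun ij t => boundary_weight u (fun v => omega v t) z ij)
    (fun ij => exponential_law (boundary_rate_gt0 ij u01)).
Proof.
move=> indO expO.
have msc (c : R) (A : set R) : measurable (A : set mR) ->
    measurable ((fun r => r / c) @^-1` A : set mR).
  move=> mA.
  have h : measurable_fun [set: mR] (fun r : R => r / c) by exact: measurable_funM.
  by have := h measurableT A mA; rewrite setTI.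
split=> [ij|s A us mA].
  apply: measurable_funM => //; exact: measurable_funP.
(* [idx] is a left inverse of the embedding of the quadrant at [z]; through it, events indexed by
   pairs become events indexed by sites. *)
pose idx (v : site) : nat * nat := (`|v.1 - z.1|%N, `|v.2 - z.2|%N).
have idxK ij : idx (site_shift z ij.1 ij.2) = ij.
  by rewrite /idx /site_shift [RHS]surjective_pairing; congr (_, _) => /=; lia.
pose A' v := (fun r => r / boundary_rate u (idx v)) @^-1` A (idx v).
have := indO [seq site_shift z ij.1 ij.2 | ij <- s] A' _ _.
rewrite big_map.
rewrite (_ : \bigcap_(i in _) _ =
  \bigcap_(i in [set` s]) ((fun t => boundary_weight u (fun v => omega v t) z i) @^-1` A i)).
  move=> ->.
  - apply: eq_bigr => ij _; rewrite /A' idxK.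
    rewrite -[LHS]/(distribution P (omega (site_shift z ij.1 ij.2)) _) expO; last exact: msc.
    exact: exponential_prob_scale (boundary_rate_gt0 ij u01) (mA ij).
  - by rewrite map_inj_uniq// => a b ab; rewrite -(idxK a) ab idxK.
  - by move=> v; exact: msc.
rewrite predeqE => t; split=> H v /= vs.
  have := H (site_shift z v.1 v.2); rewrite /= /A' idxK; apply.
  exact: map_f.
by case/mapP: vs => ij ijs ->; have := H ij ijs; rewrite /= /A' idxK.
Qed.

(** The three slots of each flip have rates [u], [1 - u] and 1, and the first two add up to the
    third, as the flip requires. *)
Lemma burke_row_independent (X : nat * nat -> T -> R) (m : nat * nat -> probability mR R)
    (u : R) (j i : nat) : 0 < u < 1 -> (0 < j)%N ->
  (forall ij, is_exp (boundary_rate u ij) (m ij)) ->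
  independent_with P X m ->
  independent_with P (fun l t => burke_row j i (X^~ t) l) m.
Proof.
move=> /andP[u0 u1] j0 em indX; elim: i => //= i IH.
have := @burke_flip_independent R _ T P _ (i.+1, 0%N) (0%N, j) (i.+1, j)
  (fun l t => burke_row j i (X^~ t) l) m u (1 - u).
apply; rewrite ?xpair_eqE ?subr_gt0//=; try lia.
- by rewrite addrC subrK.
- exact: (em (i.+1, 0%N)).
- exact: (em (0%N, j)).
by have := em (i.+1, j); rewrite /boundary_rate /=; case: j j0 {IH}.
Qed.

Lemma burke_rect_independent (X : nat * nat -> T -> R) (m : nat * nat -> probability mR R)
    (u : R) (p j : nat) : 0 < u < 1 ->
  (forall ij, is_exp (boundary_rate u ij) (m ij)) ->
  independent_with P X m ->
  independent_with P (fun l t => burke_rect p j (X^~ t) l) m.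
Proof.
move=> u01 em indX; elim: j => //= j IH.
exact: (burke_row_independent p (X := fun l t => burke_rect p j (X^~ t) l) u01).
Qed.

(** The two sums add up to [stationary_time p x p q]. Each has independent terms of a single rate,
    the second one by Burke's property, so they are controlled separately, whatever their joint
    law. *)
Definition stationary_typical (w : site -> R) (e : R) (z : site) (p q : nat) (u : R) : Prop :=
  let x := boundary_weight u w z in
  `|\sum_(0 <= l < q.+1) x (0%N, l) - q.+1%:R / (1 - u)| <= e /\
  `|\sum_(1 <= k < p.+1) burke_rect p q x (k, 0%N) - p%:R / u| <= e.

Lemma measurable_deviation (I : eqType) (X : I -> T -> R) m (s : seq I) (a e : R) :
  independent_with P X m ->
  measurable [set t | (e < `|(\sum_(i <- s) X i t) - a|)%R].
Proof.
move=> indX.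
rewrite (_ : [set t | _] = (fun t => `|(\sum_(i <- s) X i t) - a|) @^-1` `]e, +oo[%classic).
  apply: measurable_rv; last exact: measurable_itv.
  apply: measurableT_comp => //; apply: measurable_funB => //.
  by apply: measurable_sum => i; exact: indX.1.
by rewrite predeqE => t; rewrite /= in_itv/= andbT.
Qed.

Lemma stationary_typical_prob (omega : site -> {RV P >-> R}) (lam0 delta N : R)
    (z : site) (p q : nat) (u : R) :
  mutually_independent omega -> (forall v, has_exponential_law 1 (omega v)) ->
  0 < lam0 -> lam0 <= 1 -> 0 < delta -> delta <= 1 -> lam0 <= u -> u <= 1 - lam0 ->
  p%:R <= N -> q.+1%:R <= N ->
  let B := [set t | ~ stationary_typical (fun v => omega v t) (delta * N) z p q u] in
  measurable B /\
  (P B <= (4 * expR (- (delta ^+ 2 * lam0 ^+ 2 / 8 * N)))%:E)%E.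
Proof.
move=> indO expO l0 l1 d0 d1 lu ul pN qN B.
have u01 : 0 < u < 1 by lra.
set X := fun ij t => boundary_weight u (fun v => omega v t) z ij.
have indX := boundary_weight_independent z u01 indO expO.
set m := (fun ij => exponential_law _) in indX.
have em ij : is_exp (boundary_rate u ij) (m ij) by exact: is_exp_exponential_law.
have indY := burke_rect_independent p q u01 em indX.
pose s1 : seq (nat * nat) := [seq (0%N, l) | l <- index_iota 0 q.+1].
pose s2 : seq (nat * nat) := [seq (k, 0%N) | k <- index_iota 1 p.+1].
pose B1 := [set t | (delta * N < `|(\sum_(i <- s1) X i t) - q.+1%:R / (1 - u)|)%R].
pose B2 := [set t | (delta * N < `|(\sum_(i <- s2) burke_rect p q (X^~ t) i) - p%:R / u|)%R].
have BE : B = B1 `|` B2.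
  rewrite predeqE => t; rewrite /B /B1 /B2 /stationary_typical /= /s1 /s2 !big_map.
  split; last by case; rewrite ltNge => /negP H []; [move=> /H|move=> _ /H].
  by move=> H; apply: contrapT => /not_orP[]; rewrite !ltNge => /negP/negPn h1 /negP/negPn h2; exact: H.
have mB1 : measurable B1 by exact: measurable_deviation indX.
have mB2 : measurable B2 by exact: measurable_deviation indY.
split; first by rewrite BE; exact: measurableU.
rewrite BE; apply: (le_trans (measureU2 _ _ _)) => //.
have -> : 4 * expR (- (delta ^+ 2 * lam0 ^+ 2 / 8 * N)) =
  2 * expR (- (delta ^+ 2 * lam0 ^+ 2 / 8 * N)) +
  2 * expR (- (delta ^+ 2 * lam0 ^+ 2 / 8 * N)) by ring.
rewrite EFinD; apply: leeD.
  have sz : size s1 = q.+1 by rewrite size_map size_iota subn0.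
  rewrite /B1 -sz; apply: (exponential_sum_deviation indX) => //.
  - by move=> i /mapP[l _ ->]; exact: (em (0%N, l)).
  - by rewrite map_inj_uniq ?iota_uniq// => a b [].
  - lra.
  - by rewrite sz.
have sz : size s2 = p by rewrite size_map size_iota subn1.
have := exponential_sum_deviation (lam := u) (lam0 := lam0) (delta := delta) (N := N) (s := s2) indY.
rewrite sz; apply => //.
- move=> i /mapP[k]; rewrite mem_index_iota => /andP[k0 _] ->.
  by have := em (k, 0%N); rewrite /boundary_rate /=; case: k k0.
- by rewrite map_inj_uniq ?iota_uniq// => a b [].
Qed.

End stationary_deviation.

(** * The limit shape *)

Section limit_shape.
Context (R : realType).
Implicit Types p q a b k : R.

Definition limit_shape p q : R := (Num.sqrt p + Num.sqrt q) ^+ 2.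

Lemma limit_shapeC p q : limit_shape p q = limit_shape q p.
Proof. by rewrite /limit_shape addrC. Qed.

Lemma le_limit_shape p q p' q' : p <= p' -> q <= q' -> limit_shape p q <= limit_shape p' q'.
Proof.
move=> pp qq; rewrite lerXn2r ?nnegrE ?addr_ge0 ?sqrtr_ge0//.
by apply: lerD; apply: ler_wsqrtr.
Qed.

(** A quantitative strict concavity. With capital letters for square roots and [S = C D + E F], the
    difference of shapes is [2 (P Q - S)], and [(P Q)^2 - S^2 = (C F - D E)^2]. Then [P Q + S <= n]
    and [2 (C F + D E) <= n] bring in the cross product [c f - d e = (C F - D E)(C F + D E)], which
    measures the departure from the segment. *)
Lemma limit_shape_concave (c d e f n : R) : 0 <= c -> 0 <= d -> 0 <= e -> 0 <= f ->
  n = c + d + e + f ->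
  8 * (c * f - d * e) ^+ 2 <=
  n ^+ 3 * (limit_shape (c + e) (d + f) - limit_shape c d - limit_shape e f).
Proof.
move=> c0 d0 e0 f0 nE0.
rewrite /limit_shape.
have [sc sd] := (sqr_sqrtr c0, sqr_sqrtr d0).
have [se sf] := (sqr_sqrtr e0, sqr_sqrtr f0).
have sp := sqr_sqrtr (addr_ge0 c0 e0); have sq := sqr_sqrtr (addr_ge0 d0 f0).
move: (sqrtr_ge0 c) (sqrtr_ge0 d) (sqrtr_ge0 e) (sqrtr_ge0 f)
  (sqrtr_ge0 (c + e)) (sqrtr_ge0 (d + f)).
move: (Num.sqrt c) (Num.sqrt d) (Num.sqrt e) (Num.sqrt f)
  (Num.sqrt (c + e)) (Num.sqrt (d + f)) sc sd se sf sp sq.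
move=> C D E F P Q sc sd se sf sp sq C0 D0 E0 F0 P0 Q0.
have nE : n = C ^+ 2 + D ^+ 2 + E ^+ 2 + F ^+ 2 by rewrite nE0; lra.
have n0 : 0 <= n by rewrite nE; rewrite !addr_ge0 ?sqr_ge0.
set S := C * D + E * F; set M := (C * F - D * E) ^+ 2.
have S0 : 0 <= S by rewrite /S addr_ge0 ?mulr_ge0.
have PQ2 : (P * Q) ^+ 2 - S ^+ 2 = M.
  by rewrite exprMn sp sq -sc -sd -se -sf /S /M; ring.
have M0 : 0 <= M by exact: sqr_ge0.
have PQS : S <= P * Q.
  by rewrite -(ler_pXn2r (_ : (0 < 2)%N)) ?nnegrE ?mulr_ge0//; lra.
have h1 : M <= n * (P * Q - S).
  rewrite -PQ2 subr_sqr mulrC ler_wpM2r ?subr_ge0//.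
  have := sqr_ge0 (P - Q); rewrite nE0; nra.
have h2 : 4 * (c * f - d * e) ^+ 2 <= n ^+ 2 * M.
  have -> : c * f - d * e = (C * F - D * E) * (C * F + D * E).
    by rewrite -sc -sd -se -sf; ring.
  have h : 2 * (C * F + D * E) <= n.
    rewrite nE; have := sqr_ge0 (C - F); have := sqr_ge0 (D - E); lra.
  have {h} : (2 * (C * F + D * E)) ^+ 2 <= n ^+ 2.
    by rewrite lerXn2r ?nnegrE// mulr_ge0 ?addr_ge0 ?mulr_ge0.
  rewrite exprMn [X in X <= _]mulrC -!mulrA mulrC => h.
  have := ler_wpM2r M0 h; rewrite /M; lra.
have h3 : n ^+ 2 * M <= n ^+ 2 * (n * (P * Q - S)).
  by rewrite ler_wpM2l ?sqr_ge0.
have -> : (P + Q) ^+ 2 - (C + D) ^+ 2 - (E + F) ^+ 2 = 2 * (P * Q - S).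
  rewrite !sqrrD sp sq sc sd se sf /S; ring.
have : n ^+ 3 * (2 * (P * Q - S)) = 2 * (n ^+ 2 * (n * (P * Q - S))) by ring.
lra.
Qed.

(** Adding [eta * sqrt N] to both roots of the exact minimizer bounds the two terms by [a D] and
    [b D], where [a] and [b] are the roots and [D] is the new denominator. Thus the sum is at most
    [(a + b) D], which exceeds [(a + b)^2] by at most [4 * eta * N]. *)
Lemma limit_shape_upper (eta N p q : R) : 0 < eta -> eta <= 1 -> 0 < N ->
  0 <= p -> p <= N -> 0 <= q -> q <= N ->
  let u := (Num.sqrt p + eta * Num.sqrt N) /
           (Num.sqrt p + Num.sqrt q + 2 * eta * Num.sqrt N) in
  [/\ eta / 4 <= u, u <= 1 - eta / 4 &
   p / u + q / (1 - u) <= limit_shape p q + 4 * eta * N].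
Proof.
move=> e0 e1 N0 p0 pN q0 qN; rewrite /limit_shape.
have as_ : Num.sqrt p <= Num.sqrt N by exact: ler_wsqrtr.
have bs : Num.sqrt q <= Num.sqrt N by exact: ler_wsqrtr.
have s0 : 0 < Num.sqrt N by rewrite sqrtr_gt0.
move: (sqr_sqrtr p0) (sqr_sqrtr q0) (sqr_sqrtr (ltW N0)).
move: (sqrtr_ge0 p) (sqrtr_ge0 q) as_ bs s0.
move: (Num.sqrt p) (Num.sqrt q) (Num.sqrt N) => a b s a0 b0 as_ bs s0 <- <- <-.
have es0 : 0 < eta * s by rewrite mulr_gt0.
have D0 : 0 < a + b + 2 * eta * s by lra.
have es1 : eta * s <= s by rewrite ler_piMl// ltW.
have ees : eta * (eta * s) <= eta * s by rewrite ler_piMl// ltW.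
have ea : eta * a <= eta * s by rewrite ler_wpM2l// ltW.
have eb : eta * b <= eta * s by rewrite ler_wpM2l// ltW.
have u' : 1 - (a + eta * s) / (a + b + 2 * eta * s) = (b + eta * s) / (a + b + 2 * eta * s).
  by field; lra.
split.
- by rewrite ler_pdivlMr//; lra.
- by rewrite lerBrDr addrC -lerBrDr u' ler_pdivlMr//; lra.
rewrite u' !invf_div.
have quot x : 0 <= x -> x ^+ 2 * ((a + b + 2 * eta * s) / (x + eta * s)) <=
    x * (a + b + 2 * eta * s).
  move=> x0; have xs : 0 < x + eta * s by lra.
  rewrite mulrA ler_pdivrMr//.
  have : 0 <= x * (a + b + 2 * eta * s) * (eta * s) by rewrite !mulr_ge0// ltW.
  lra.
have := quot a a0; have := quot b b0.
have : 0 <= s * (eta * s - eta * a) by rewrite mulr_ge0 ?subr_ge0// ltW.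
have : 0 <= s * (eta * s - eta * b) by rewrite mulr_ge0 ?subr_ge0// ltW.
lra.
Qed.

(* The stationary bound [A (a + b) / a + G'] overshoots the point-to-point bound [A + G']
   by about [y = k b / a]; strict concavity of the limit shape caps [y]. *)
Lemma limit_shape_exit (a b k A G0 G' st e e1 e2 e3 e4 : R) :
  0 < a -> 0 < b -> 0 <= k -> k <= a ^+ 2 -> A <= k + e1 ->
  st <= A * ((a + b) / a) + e2 + G' -> A + G' <= G0 ->
  G' <= (Num.sqrt (a ^+ 2 - k) + b) ^+ 2 + e3 -> (a + b) ^+ 2 - e4 <= st ->
  e1 * ((a + b) / a) <= e -> 0 <= e1 ->
  G0 >= (a + b) ^+ 2 - e4 - e2 - e - Num.sqrt (4 * (a * b) * (e + e2 + e3 + e4)).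
Proof.
move=> a0 b0 k0 ka Ak stA G0A G'e ste e1e e10.
have ak0 : 0 <= a ^+ 2 - k by rewrite subr_ge0.
have := sqr_sqrtr ak0; have := sqrtr_ge0 (a ^+ 2 - k).
move: (Num.sqrt (a ^+ 2 - k)) G'e => r G'e r0 rE.
set y := k * (b / a).
have [a0' b0'] := (ltW a0, ltW b0).
have y0 : 0 <= y by rewrite /y mulr_ge0// divr_ge0.
have abE : (a + b) / a = 1 + b / a by field; lra.
have ba0 : 0 <= b / a by rewrite divr_ge0.
rewrite abE in stA e1e.
have Ay : A * (b / a) <= y + e1 * (b / a).
  by rewrite /y -mulrDl ler_wpM2r.
(* Leaving the axis at [k] gives the mean [k (a + b) / a + (r + b)^2], with [r^2 = a^2 - k], which
   falls short of [(a + b)^2] by exactly this amount. *)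
have gap : b / a * (a - r) ^+ 2 <= e + e2 + e3 + e4.
  have -> : b / a * (a - r) ^+ 2 = (a + b) ^+ 2 - (k * (1 + b / a) + (r + b) ^+ 2).
    have -> : k = a ^+ 2 - r ^+ 2 by lra.
    by field; lra.
  have : A * (1 + b / a) <= (k + e1) * (1 + b / a) by rewrite ler_wpM2r// addr_ge0.
  lra.
(* From [k = (a - r)(a + r)] and [r <= a] follows [y <= 2 b (a - r)], whose square is [4 a b] times
   the shortfall. *)
have yy : y ^+ 2 <= 4 * (a * b) * (e + e2 + e3 + e4).
  apply: (@le_trans _ _ (4 * (a * b) * (b / a * (a - r) ^+ 2))); last first.
    by rewrite ler_wpM2l// !mulr_ge0.
  have -> : 4 * (a * b) * (b / a * (a - r) ^+ 2) = (2 * b * (a - r)) ^+ 2 by field; lra.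
  have ra : r <= a.
    by rewrite -(ler_pXn2r (_ : (0 < 2)%N)) ?nnegrE//; lra.
  rewrite lerXn2r ?nnegrE//; first by rewrite !mulr_ge0 ?subr_ge0.
  rewrite /y mulrA ler_pdivrMr// (_ : k = (a - r) * (a + r)); last by rewrite -subr_sqr; lra.
  have : 0 <= (a - r) * b * (a - r) by rewrite !mulr_ge0 ?subr_ge0.
  lra.
have ys : y <= Num.sqrt (4 * (a * b) * (e + e2 + e3 + e4)).
  by rewrite -[leLHS](ger0_norm y0) -sqrtr_sqr; exact: ler_wsqrtr.
lra.
Qed.

End limit_shape.

(** * Typical environments *)

Section typical_environment.
Context (R : realType) (eta N : R) (n : nat).

(* [c = 0] is a minimizer of [p / u + q / (1 - u)] kept away from [0] and [1], for the upper
   bounds; [c = 1] is the exact minimizer, for the lower bound; with the remaining value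
   [1 / 2] the boundary sums give the law of large numbers on the axes. *)
Definition slope (c : 'I_3) (p q : nat) : R :=
  let a : R := Num.sqrt p%:R in let b : R := Num.sqrt q%:R in
  let half : R := 2^-1 in
  match val c with
  | 0%N => (a + eta * Num.sqrt N) / (a + b + 2 * eta * Num.sqrt N)
  | 1%N => if (eta ^+ 2 * N <= p%:R) && (eta ^+ 2 * N <= q%:R) then a / (a + b)
           else half
  | _ => half
  end.

Hypothesis eta0 : 0 < eta.
Hypothesis eta1 : eta <= 1.
Hypothesis NE : N = n.+1%:R.

Let N0 : 0 < N. Proof. by rewrite NE ltr0n. Qed.

Let leN p : (p <= n)%N -> p%:R <= N.
Proof. by move=> pn; rewrite NE ler_nat ltnW. Qed.

Let sqrt_bounds p : (p <= n)%N -> eta ^+ 2 * N <= p%:R ->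
  eta * Num.sqrt N <= Num.sqrt p%:R <= Num.sqrt N.
Proof.
move=> pn h; rewrite ler_wsqrtr ?leN// andbT.
have -> : eta * Num.sqrt N = Num.sqrt (eta ^+ 2 * N).
  by rewrite sqrtrM ?sqr_ge0// sqrtr_sqr ger0_norm// ltW.
exact: ler_wsqrtr.
Qed.

Lemma slope_range c p q : (p <= n)%N -> (q <= n)%N ->
  eta / 4 <= slope c p q /\ slope c p q <= 1 - eta / 4.
Proof.
have [e0 e1] := (eta0, eta1).
move=> pn qn; rewrite /slope; case: (val c) => [|[|m]].
- by have [] := @limit_shape_upper R eta N p%:R q%:R eta0 eta1 N0 (ler0n _ _) (leN pn) (ler0n _ _) (leN qn).
- case: ifPn => [/andP[hp hq]|_]; last by split; lra.
  have /andP[a1 a2] := sqrt_bounds pn hp; have /andP[b1 b2] := sqrt_bounds qn hq.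
  have s0 : 0 < Num.sqrt N by rewrite sqrtr_gt0.
  move: (Num.sqrt N) (Num.sqrt p%:R) (Num.sqrt q%:R) s0 a1 a2 b1 b2 => s a b s0 a1 a2 b1 b2.
  have es0 : 0 < eta * s by rewrite mulr_gt0.
  have ab0 : 0 < a + b by lra.
  have ea : eta * a <= eta * s by rewrite ler_wpM2l// ltW.
  have eb : eta * b <= eta * s by rewrite ler_wpM2l// ltW.
  split; first by rewrite ler_pdivlMr//; lra.
  have -> : a / (a + b) = 1 - b / (a + b) by field; lra.
  by rewrite lerD2l lerN2 ler_pdivlMr//; lra.
- by split; lra.
Qed.

Context (w : site -> R).
Hypothesis w0 : forall v, 0 <= w v.
Hypothesis typical : forall (i j p q : nat) (c : 'I_3),
  (i <= n)%N -> (j <= n)%N -> (p <= n)%N -> (q <= n)%N ->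
  stationary_typical w (eta ^+ 2 * N) (site_shift 0 i j) p q (slope c p q).
Hypothesis big_n : 4 <= eta ^+ 2 * N.

(** Absorbs the mean of the one additional column term, [(1 - u)^-1 <= 4 / eta], into the error
    [eta * N]. *)
Let einv : 4 / eta <= eta * N.
Proof. by rewrite ler_pdivrMr// mulrAC -expr2. Qed.

Let eta2 : eta ^+ 2 * N <= eta * N.
Proof. by rewrite ler_pM2r// expr2 ler_piMl// ltW. Qed.

Let slope_lt c p q : (p <= n)%N -> (q <= n)%N -> 0 < slope c p q < 1.
Proof. by move=> pn qn; have e0 := eta0; have [] := slope_range c pn qn; lra. Qed.

Let boundary_bulk u z i j : boundary_weight u w z (i.+1, j.+1) = w (site_shift z i.+1 j.+1).
Proof. by rewrite /boundary_weight /boundary_rate /= divr1. Qed.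

Let stationary_timeE c i j p q u : (i <= n)%N -> (j <= n)%N -> (p <= n)%N -> (q <= n)%N ->
  u = slope c p q ->
  `|stationary_time p (boundary_weight u w (site_shift 0 i j)) p q -
    (p%:R / u + q.+1%:R / (1 - u))| <= 2 * (eta ^+ 2 * N).
Proof.
move=> iN jN pn qn ->; have [] := typical c iN jN pn qn.
rewrite /stationary_time !ler_norml => /andP[? ?] /andP[? ?].
by apply/andP; split; lra.
Qed.

(** The constant is [7 = 2 + 1 + 4]: the fluctuations of the two sums, the additional column term,
    and the regularization of the slope. *)
Lemma last_passage_upper i j p q :
  (i <= n)%N -> (j <= n)%N -> (p <= n)%N -> (q <= n)%N ->
  last_passage w (site_shift 0 i j) (site_shift (site_shift 0 i j) p q) <=
  limit_shape p%:R q%:R + 7 * eta * N.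
Proof.
have [e0 [e1 [e2 e3]]] := (eta0, (eta1, (eta2, einv))).
move=> iN jN pn qn; set z := site_shift 0 i j.
pose c : 'I_3 := ord0; set u := slope c p q.
have u01 := slope_lt c pn qn; rewrite -/u in u01.
have [u1 u2] := slope_range c pn qn; rewrite -/u in u1 u2.
have wle v ij : w v <= w v / boundary_rate u ij.
  have b0 := boundary_rate_gt0 ij u01.
  rewrite ler_pdivlMr// ler_piMr//.
  by rewrite /boundary_rate; case: ifP => _; [lra|case: ifP => _; lra].
have := last_passage_le_stationary (boundary_bulk u z) p q (wle _ _)
  (fun i => wle _ _) (fun j => wle _ _).
have := stationary_timeE (c := c) iN jN pn qn (erefl u); rewrite -/z ler_norml => /andP[_].
have H3 : p%:R / u + q%:R / (1 - u) <= limit_shape p%:R q%:R + 4 * eta * N.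
  by have [] := @limit_shape_upper R eta N p%:R q%:R eta0 eta1 N0 (ler0n _ _) (leN pn) (ler0n _ _) (leN qn).
have H4 : (1 - u)^-1 <= 4 / eta.
  by rewrite -[4 / eta]invf_div lef_pV2 ?posrE ?divr_gt0//; lra.
have -> : q.+1%:R / (1 - u) = q%:R / (1 - u) + (1 - u)^-1 by rewrite -natr1; ring.
by clearbody u; lra.
Qed.

(** * The matching lower bound from the origin *)

Local Notation G := (last_passage w).
Local Notation pt := (site_shift 0).

(** As in [stationary_time], the corner is counted in [column] and left out of [line]. *)
Let column l := \sum_(0 <= j < l.+1) w (pt 0 j).
Let line k := \sum_(1 <= i < k.+1) w (pt i 0).

Let column_le q : column q <= G (pt 0 0) (pt 0 q).
Proof.
elim: q => [|q IH]; rewrite /column; first by rewrite big_nat1 last_passage_refl.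
rewrite big_nat_recr//=; apply: le_trans (last_passage_step w (site_shift_le 0 (leqnn 0) (leq0n q)) (site_shift_up 0 0 q)).
by rewrite lerD2r.
Qed.

Let line_le p : w (pt 0 0) + line p <= G (pt 0 0) (pt p 0).
Proof.
elim: p => [|p IH]; rewrite /line; first by rewrite big_geq// addr0 last_passage_refl.
rewrite big_nat_recr//= addrA; apply: le_trans (last_passage_step w (site_shift_le 0 (leq0n p) (leqnn 0)) (site_shift_right 0 p 0)).
by rewrite lerD2r.
Qed.

Let slope_half p q : slope ord_max p q = 2^-1.
Proof. by []. Qed.

(** At slope [1 / 2] every boundary weight is doubled, so the error is halved on returning to
    [w]. *)
Let column_typical q : (q <= n)%N -> `|column q - q.+1%:R| <= eta ^+ 2 * N / 2.
Proof.
move=> qn; have [+ _] := typical ord_max (leq0n n) (leq0n n) (leq0n n) qn.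
rewrite slope_half /boundary_weight /boundary_rate /= -mulr_suml -/(column q).
have -> : 1 - 2^-1 = 2^-1 :> R by field.
by rewrite invrK -mulrBl normrM [`|2|]ger0_norm// ler_pdivlMr.
Qed.

Let line_typical p : (p <= n)%N -> `|line p - p%:R| <= eta ^+ 2 * N / 2.
Proof.
move=> pn; have [_] := typical ord_max (leq0n n) (leq0n n) pn (leq0n n).
rewrite slope_half /= (_ : \sum_(_ <= _ < _) _ = line p / 2^-1); last first.
  rewrite /line mulr_suml; apply: eq_big_nat => k /andP[k0 _].
  by rewrite /boundary_weight /boundary_rate /=; case: k k0.
by rewrite invrK -mulrBl normrM [`|2|]ger0_norm// ler_pdivlMr.
Qed.

(** The step up from [pt k 0] gains the weight of [pt k 1], which pays for its double count in the
    concatenation. This is the hypothesis [A + G' <= G0] of [limit_shape_exit]. *)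
Let line_concat k p q : (k <= p)%N -> (0 < q)%N ->
  line k + G (pt k 1) (pt p q) <= G (pt 0 0) (pt p q).
Proof.
move=> kp q0.
have h1 := last_passage_step w (site_shift_le 0 (leq0n k) (leqnn 0)) (site_shift_right 0 k 0).
have h2 := last_passage_step w (site_shift_le 0 (leq0n k) (leqnn 0)) (site_shift_up 0 k 0).
have h3 := last_passage_concat w (site_shift_le 0 (leq0n k) (leq0n 1)) (site_shift_le 0 kp q0).
have := line_le k; have := w0 (pt 0 0); lra.
Qed.

Let column_concat l p q : (l <= q)%N -> (0 < p)%N ->
  column l + G (pt 1 l) (pt p q) <= G (pt 0 0) (pt p q).
Proof.
move=> lq p0.
have h2 := last_passage_step w (site_shift_le 0 (leqnn 0) (leq0n l)) (site_shift_right 0 0 l).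
have h3 := last_passage_concat w (site_shift_le 0 (leq0n 1) (leq0n l)) (site_shift_le 0 p0 lq).
have := column_le l; lra.
Qed.

Let upper_from i j p q : (i <= p <= n)%N -> (j <= q <= n)%N ->
  G (pt i j) (pt p q) <= limit_shape (p - i)%:R (q - j)%:R + 7 * eta * N.
Proof.
move=> /andP[ip pn] /andP[jq qn].
have -> : pt p q = site_shift (pt i j) (p - i) (q - j).
  by rewrite /site_shift /=; congr (_, _); lia.
by apply: last_passage_upper; lia.
Qed.

Let theta : R := Num.sqrt eta.
Let theta0 : 0 < theta. Proof. by rewrite sqrtr_gt0. Qed.
Let theta1 : theta <= 1. Proof. by rewrite -sqrtr1 ler_wsqrtr. Qed.
Let thetaE : theta ^+ 2 = eta. Proof. by rewrite sqr_sqrtr// ltW. Qed.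

(** The loss is of order [theta = sqrt eta] because the exit argument bounds the square of the
    boundary overshoot by a multiple of [N * (eta * N)]. *)
Lemma last_passage_lower p q : (p <= n)%N -> (q <= n)%N ->
  limit_shape p%:R q%:R - 16 * theta * N <= G (pt 0 0) (pt p q).
Proof.
move=> pn qn.
have eN : eta * N <= theta * N.
  by rewrite ler_pM2r// -thetaE expr2 ler_piMl// ltW.
have [[h_e0 h_e1] [h_e2 h_e3]] := ((eta0, eta1), (eta2, einv)).
have [h_N0 h_big] := (N0, big_n).
have eN0 : 0 < eta * N by rewrite mulr_gt0.
have edge a b : (a <= n)%N -> (b <= n)%N -> a%:R < eta ^+ 2 * N ->
    limit_shape a%:R b%:R <= b%:R + 3 * eta * N.
  move=> an bn ha; rewrite /limit_shape sqrrD !sqr_sqrtr//.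
  have h1 : Num.sqrt a%:R <= eta * Num.sqrt N.
    have -> : eta * Num.sqrt N = Num.sqrt (eta ^+ 2 * N).
      by rewrite sqrtrM ?sqr_ge0// sqrtr_sqr ger0_norm// ltW.
    by apply: ler_wsqrtr; exact: ltW.
  have h2 : Num.sqrt b%:R <= Num.sqrt N by apply: ler_wsqrtr; exact: leN.
  have h3 : Num.sqrt a%:R * Num.sqrt b%:R <= eta * Num.sqrt N * Num.sqrt N.
    by apply: ler_pM; rewrite ?sqrtr_ge0.
  have : eta * Num.sqrt N * Num.sqrt N = eta * N.
    by rewrite -mulrA -expr2 sqr_sqrtr// ltW.
  by rewrite mulr2n; lra.
(* Near an axis the exact slope degenerates, but by [edge] the limit shape is then almost the length
   along that axis. A path along the axis followed by a straight segment is heavy enough, since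
   weights are nonnegative. *)
have [hp|hp] := ltP p%:R (eta ^+ 2 * N).
  have h1 := edge p q pn qn hp.
  have := column_typical qn; rewrite ler_norml -[q.+1%:R]natr1 => /andP[+ _].
  have := column_le q.
  have := last_passage_concat w (site_shift_le 0 (leqnn 0) (leq0n q)) (site_shift_le 0 (leq0n p) (leqnn q)).
  have := last_passage_ge_start w0 (site_shift_le 0 (leq0n p) (leqnn q)).
  lra.
have [hq|hq] := ltP q%:R (eta ^+ 2 * N).
  have h1 := edge q p qn pn hq; rewrite limit_shapeC in h1.
  have := line_typical pn; rewrite ler_norml => /andP[+ _].
  have := line_le p; have := w0 (pt 0 0).
  have := last_passage_concat w (site_shift_le 0 (leq0n p) (leqnn 0)) (site_shift_le 0 (leqnn p) (leq0n q)).
  have := last_passage_ge_start w0 (site_shift_le 0 (leqnn p) (leq0n q)).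
  lra.
pose c : 'I_3 := @Ordinal 3 1 isT.
have uE : slope c p q = Num.sqrt p%:R / (Num.sqrt p%:R + Num.sqrt q%:R).
  by rewrite /slope /= hp hq.
have := stationary_timeE (c := c) (leq0n n) (leq0n n) pn qn (erefl _); rewrite uE.
have /andP[a1 a2] := sqrt_bounds pn hp; have /andP[b1 b2] := sqrt_bounds qn hq.
have s0 : 0 < Num.sqrt N by rewrite sqrtr_gt0.
have sN := sqr_sqrtr (ltW N0); have sp := sqr_sqrtr (ler0n R p); have sq := sqr_sqrtr (ler0n R q).
have es0 : 0 < eta * Num.sqrt N by rewrite mulr_gt0.
have p0 : (0 < p)%N by rewrite -(ltr0n R); apply: lt_le_trans hp; rewrite mulr_gt0// exprn_gt0.
have q0 : (0 < q)%N by rewrite -(ltr0n R); apply: lt_le_trans hq; rewrite mulr_gt0// exprn_gt0.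
rewrite {1}/limit_shape.
set a := Num.sqrt p%:R in uE a1 a2 sp *; set b := Num.sqrt q%:R in uE b1 b2 sq *.
set s := Num.sqrt N in s0 sN es0 a1 a2 b1 b2.
have a0 : 0 < a by lra.
have b0 : 0 < b by lra.
set u := a / (a + b) in uE *.
have u'E : 1 - u = b / (a + b) by rewrite /u; field; lra.
have iu : u^-1 = (a + b) / a by rewrite invf_div.
have iu' : (1 - u)^-1 = (a + b) / b by rewrite u'E invf_div.
have ba : (a + b) / a <= 2 / eta.
  rewrite ler_pdivrMr// mulrAC ler_pdivlMr//.
  have : eta * b <= eta * s by rewrite ler_wpM2l// ltW.
  have : eta * a <= a by rewrite ler_piMl// ltW.
  lra.
have ab : (a + b) / b <= 2 / eta.
  rewrite ler_pdivrMr// mulrAC ler_pdivlMr//.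
  have : eta * a <= eta * s by rewrite ler_wpM2l// ltW.
  have : eta * b <= b by rewrite ler_piMl// ltW.
  lra.
(* The reason for the precision [eta ^+ 2 * N]: multiplied by boundary factors up to [2 / eta],
   errors remain of order [eta * N]. *)
have small x : x <= 1 + eta ^+ 2 * N / 2 -> 0 <= x -> x * (2 / eta) <= 2 * eta * N.
  move=> x1 x0.
  apply: (@le_trans _ _ ((1 + eta ^+ 2 * N / 2) * (2 / eta))).
    by rewrite ler_wpM2r// divr_ge0// ltW.
  have -> : (1 + eta ^+ 2 * N / 2) * (2 / eta) = (4 / eta) / 2 + eta * N by field; lra.
  lra.
have e10 : 0 <= eta ^+ 2 * N / 2 by lra.
have stE : a ^+ 2 / u + b ^+ 2 / (1 - u) = (a + b) ^+ 2.
  by rewrite iu iu'; field; lra.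
(* The errors passed to [limit_shape_exit] add up to [2 + 2 + 7 + 2 = 13] times [eta * N]; then
   [4 * 13 <= 8 ^ 2]. *)
have sqrt_le : Num.sqrt (4 * (a * b) * (13 * eta * N)) <= 8 * theta * N.
  have -> : 8 * theta * N = Num.sqrt ((8 * theta * N) ^+ 2).
    by rewrite sqrtr_sqr ger0_norm// !mulr_ge0// ltW.
  apply: ler_wsqrtr; rewrite !exprMn thetaE.
  have abN : a * b <= N by rewrite -sN expr2; apply: ler_pM => //; exact: ltW.
  have : a * b * (eta * N) <= N * (eta * N) by rewrite ler_wpM2r// ltW.
  have : 0 <= N * (eta * N) by rewrite mulr_ge0// ltW.
  lra.
rewrite ler_norml -[q.+1%:R]natr1 => /andP[st1 _].
have st2 : (a + b) ^+ 2 - 2 * eta * N <= stationary_time p (boundary_weight u w (pt 0 0)) p q.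
  have : 0 <= (1 - u)^-1 by rewrite iu' divr_ge0// ?addr_ge0// ltW.
  by move: st1; rewrite -sp -sq mulrDl mul1r; clearbody u; lra.
have bulk := boundary_bulk u (pt 0 0).
have ip : (0 < p <= p)%N by rewrite p0 leqnn.
have ler_lim (m1 m2 : nat) : (m1 <= m2)%N -> m1%:R <= m2%:R :> R by rewrite ler_nat.
have [[k /andP[k0 kp] H]|[l /andP[l0 lq] H]] := stationary_time_exit bulk ip q0.
  have kn : (k <= n)%N by exact: leq_trans kp pn.
  have kE : stationary_time p (boundary_weight u w (pt 0 0)) k 0 =
      w (pt 0 0) * ((a + b) / b) + line k * ((a + b) / a).
    rewrite /stationary_time big_nat1 -iu' -iu; congr (_ + _).
    rewrite /line mulr_suml; apply: eq_big_nat => i /andP[i0 _].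
    by rewrite /= /boundary_weight /boundary_rate /=; case: i i0.
  (* For an exit on the bottom line the corner, stretched by the column's rate, is an additional
     error; its weight is bounded by [column_typical] at height 0. *)
  have w00 : w (pt 0 0) * ((a + b) / b) <= 2 * eta * N.
    apply: (@le_trans _ _ (w (pt 0 0) * (2 / eta))); first by rewrite ler_wpM2l.
    apply: small => //; have := column_typical (leq0n n).
    by rewrite /column big_nat1 ler_norml => /andP[_]; lra.
  have Ak : line k <= k%:R + eta ^+ 2 * N / 2.
    by have := line_typical kn; rewrite ler_norml => /andP[_]; lra.
  have G'e : G (pt k 1) (pt p q) <= (Num.sqrt (a ^+ 2 - k%:R) + b) ^+ 2 + 7 * eta * N.
    apply: le_trans (upper_from (_ : k <= p <= n)%N (_ : 1 <= q <= n)%N) _; rewrite ?kp ?q0//.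
    rewrite lerD2r sp -natrB//; apply: le_limit_shape => //.
    by rewrite ler_lim// leq_subr.
  have ek : eta ^+ 2 * N / 2 * ((a + b) / a) <= 2 * eta * N.
    apply: (@le_trans _ _ (eta ^+ 2 * N / 2 * (2 / eta))); first by rewrite ler_wpM2l.
    by apply: small => //; lra.
  have ka : k%:R <= a ^+ 2 by rewrite sp ler_lim.
  have stk : stationary_time p (boundary_weight u w (pt 0 0)) p q <=
      line k * ((a + b) / a) + 2 * eta * N + G (pt k 1) (pt p q).
    by apply: (le_trans H); rewrite kE lerD2r addrC lerD2l.
  have := limit_shape_exit a0 b0 (ler0n R k) ka Ak stk (line_concat kp q0) G'e st2 ek e10.
  have -> : 2 * eta * N + 2 * eta * N + 7 * eta * N + 2 * eta * N = 13 * eta * N by ring.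
  by move=> h; clearbody a b u; lra.
have ln : (l <= n)%N by exact: leq_trans lq qn.
have lE : stationary_time p (boundary_weight u w (pt 0 0)) 0 l =
    column l * ((b + a) / b).
  rewrite stationary_time0 [b + a]addrC -iu' /column mulr_suml.
  by apply: eq_bigr => i _.
(* [column l] has [l + 1] terms, the corner included; this is the additional 1. *)
have Al : column l <= l%:R + (1 + eta ^+ 2 * N / 2).
  have := column_typical ln; rewrite ler_norml -[l.+1%:R]natr1 => /andP[_]; lra.
have G'e : G (pt 1 l) (pt p q) <= (Num.sqrt (b ^+ 2 - l%:R) + a) ^+ 2 + 7 * eta * N.
  apply: le_trans (upper_from (_ : 1 <= p <= n)%N (_ : l <= q <= n)%N) _; rewrite ?lq ?p0//.
  rewrite lerD2r sq -natrB// limit_shapeC; apply: le_limit_shape => //.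
  by rewrite ler_lim// leq_subr.
have el : (1 + eta ^+ 2 * N / 2) * ((b + a) / b) <= 2 * eta * N.
  rewrite [b + a]addrC.
  apply: (@le_trans _ _ ((1 + eta ^+ 2 * N / 2) * (2 / eta))).
    by rewrite ler_wpM2l// addr_ge0.
  by apply: small => //; rewrite addr_ge0.
have lb : l%:R <= b ^+ 2 by rewrite sq ler_lim.
have stl : stationary_time p (boundary_weight u w (pt 0 0)) p q <=
    column l * ((b + a) / b) + 2 * eta * N + G (pt 1 l) (pt p q).
  apply: (le_trans H); rewrite lE lerD2r lerDl; lra.
have st2' : (b + a) ^+ 2 - 2 * eta * N <= stationary_time p (boundary_weight u w (pt 0 0)) p q.
  by rewrite [b + a]addrC.
have el0 : 0 <= 1 + eta ^+ 2 * N / 2 by rewrite addr_ge0.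
have := limit_shape_exit b0 a0 (ler0n R l) lb Al stl (column_concat lq p0) G'e st2' el el0.
have -> : 2 * eta * N + 2 * eta * N + 7 * eta * N + 2 * eta * N = 13 * eta * N by ring.
rewrite [b * a]mulrC [b + a]addrC.
by move=> h; clearbody a b u; lra.
Qed.

End typical_environment.

(** * Geodesics in a typical environment *)

Lemma site_shift_absz (z : site) : site_le 0 z -> z = site_shift 0 `|z.1| `|z.2|.
Proof.
rewrite /site_le /= => /andP[? ?]; rewrite [LHS]surjective_pairing /site_shift /=.
by congr (_, _); lia.
Qed.

Lemma site_le_absz (z x : site) : site_le 0 z -> site_le z x ->
  (`|z.1| <= `|x.1|)%N /\ (`|z.2| <= `|x.2|)%N.
Proof. by rewrite /site_le /= => /andP[? ?] /andP[? ?]; lia. Qed.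

Lemma site_shift_sub c d p q : (c <= p)%N -> (d <= q)%N ->
  site_shift 0 p q = site_shift (site_shift 0 c d) (p - c) (q - d).
Proof. by move=> cp dq; rewrite /site_shift /=; congr (_, _); lia. Qed.

(** At a geodesic site [(c, d)] the two coordinates of the deviation are [X / n] and [- X / n], with
    the cross product [X = c q - d p]. The lower bound and the two upper bounds cost
    [16 + 7 + 7 = 30] times [theta * N], at most [60 * theta * n]; concavity then gives
    [X ^ 2 <= eps ^ 2 * n ^ 4 / 4]. *)
Lemma geodesic_deviation_typical (R : realType) (eta eps : R) (n : nat) (w : site -> R)
    (x : site) :
  0 < eta -> eta <= 1 -> 0 < eps -> 30 * Num.sqrt eta <= eps ^+ 2 ->
  (forall v, 0 <= w v) ->
  (forall (i j p q : nat) (c : 'I_3),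
     (i <= n)%N -> (j <= n)%N -> (p <= n)%N -> (q <= n)%N ->
     stationary_typical w (eta ^+ 2 * n.+1%:R) (site_shift 0 i j) p q
       (slope eta n.+1%:R c p q)) ->
  4 <= eta ^+ 2 * n.+1%:R ->
  0 <= x.1 -> 0 <= x.2 -> norm1Z x = n ->
  geodesic_deviation w 0 x <= eps * n%:R.
Proof.
move=> eta0 eta1 eps0 etaeps w0 typ big x1 x2 xn.
set N : R := n.+1%:R in typ big *.
have upper := last_passage_upper eta0 eta1 (erefl N) w0 typ big.
have lower := last_passage_lower eta0 eta1 (erefl N) w0 typ big.
set theta := Num.sqrt eta in lower etaeps.
have th0 : 0 < theta by rewrite sqrtr_gt0.
have th1 : theta <= 1 by rewrite -sqrtr1 ler_wsqrtr.
have thE : theta ^+ 2 = eta by rewrite sqr_sqrtr// ltW.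
have N0 : 0 < N by rewrite ltr0n.
have etath : eta * N <= theta * N by rewrite ler_pM2r// -thE expr2 ler_piMl// ltW.
have N4 : 4 <= N.
  by apply: le_trans big _; rewrite ler_piMl ?(ltW N0)// exprn_ile1// ltW.
have NnE : N = n%:R + 1 by rewrite /N natr1.
have n0 : 0 < n%:R :> R by lra.
pose p := `|x.1|%N; pose q := `|x.2|%N.
have x0 : site_le 0 x by rewrite /site_le x1 x2.
have xE : x = site_shift 0 p q by exact: site_shift_absz.
have pq : (p + q)%N = n by [].
have pqR : p%:R + q%:R = n%:R :> R by rewrite -pq natrD.
have xx : x - 0 = x by rewrite subr0.
rewrite /geodesic_deviation xx xn.
rewrite big_seq; apply: bigmax_le => [|i]; first by rewrite mulr_ge0// ltW.
rewrite mem_index_iota ltnS => /andP[_ iN].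
have iN' : (i <= norm1Z (x - 0)%R)%N by rewrite xx xn.
have := geodesic_split w x0 iN'; cbv zeta.
move: (nth _ _ _) => z [z0 zx]; rewrite subr0 => zi split.
pose c := `|z.1|%N; pose d := `|z.2|%N.
have zE : z = site_shift 0 c d by exact: site_shift_absz.
have cd : (c + d)%N = i by [].
have [cp dq] : (c <= p)%N /\ (d <= q)%N by exact: site_le_absz.
have [pn qn] : (p <= n)%N /\ (q <= n)%N by rewrite -pq leq_addr leq_addl.
have [cn dn] := (leq_trans cp pn, leq_trans dq qn).
have h1 := lower p q pn qn.
have h2 := upper 0%N 0%N c d (leq0n n) (leq0n n) cn dn.
have h3 : last_passage w (site_shift 0 c d) (site_shift 0 p q) <=
    limit_shape (p - c)%:R (q - d)%:R + 7 * eta * N.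
  rewrite (site_shift_sub cp dq); apply: upper => //.
    exact: leq_trans (leq_subr _ _) pn.
  exact: leq_trans (leq_subr _ _) qn.
have {split} h4 : last_passage w (site_shift 0 0 0) (site_shift 0 p q) <=
    last_passage w (site_shift 0 0 0) (site_shift 0 c d) +
    last_passage w (site_shift 0 c d) (site_shift 0 p q).
  move: split; rewrite xE zE; apply: le_trans.
  by rewrite lerDl.
have [cpR dqR] : (p - c)%:R = p%:R - c%:R :> R /\ (q - d)%:R = q%:R - d%:R :> R.
  by rewrite !natrB.
have cdR : c%:R + d%:R = i%:R :> R by rewrite -cd natrD.
have := @limit_shape_concave R c%:R d%:R (p - c)%:R (q - d)%:R n%:R (ler0n _ _)
  (ler0n _ _) (ler0n _ _) (ler0n _ _).
have -> : c%:R + (p - c)%:R = p%:R :> R by rewrite cpR; lra.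
have -> : d%:R + (q - d)%:R = q%:R :> R by rewrite dqR; lra.
move=> /(_ _) h5.
have {}h5 : 8 * (c%:R * q%:R - d%:R * p%:R) ^+ 2 <=
    n%:R ^+ 3 * (limit_shape p%:R q%:R - limit_shape c%:R d%:R -
                 limit_shape (p - c)%:R (q - d)%:R) :> R.
  have -> : c%:R * q%:R - d%:R * p%:R = c%:R * (q - d)%:R - d%:R * (p - c)%:R :> R.
    by rewrite cpR dqR; ring.
  by apply: h5; rewrite cpR dqR; lra.
set X := c%:R * q%:R - d%:R * p%:R in h5.
have gap : limit_shape p%:R q%:R - limit_shape c%:R d%:R -
    limit_shape (p - c)%:R (q - d)%:R <= 60 * theta * n%:R.
  have : 0 <= theta * (n%:R - 1) by rewrite mulr_ge0 ?subr_ge0 ?(ltW th0)//; lra.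
  move: h1 h2 h3 h4 etath; rewrite NnE; lra.
have X2 : X ^+ 2 <= (eps * n%:R ^+ 2 / 2) ^+ 2.
  have h6 : n%:R ^+ 3 * (limit_shape p%:R q%:R - limit_shape c%:R d%:R -
      limit_shape (p - c)%:R (q - d)%:R) <= n%:R ^+ 3 * (60 * theta * n%:R).
    by rewrite ler_wpM2l// exprn_ge0.
  have h7 : 30 * theta * n%:R ^+ 4 <= eps ^+ 2 * n%:R ^+ 4.
    by rewrite ler_wpM2r// exprn_ge0.
  have e1 : (eps * n%:R ^+ 2 / 2) ^+ 2 = eps ^+ 2 * n%:R ^+ 4 / 4 by field.
  have e2 : n%:R ^+ 3 * (60 * theta * n%:R) = 2 * (30 * theta * n%:R ^+ 4) by ring.
  by rewrite e1; rewrite e2 in h6; move: (X ^+ 2) h5 h6 h7 => Y h5 h6 h7; lra.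
have aX : `|X| <= eps * n%:R ^+ 2 / 2.
  have b0 : 0 <= eps * n%:R ^+ 2 / 2.
    by rewrite !mulr_ge0 ?exprn_ge0 ?(ltW eps0).
  by rewrite -[leRHS](ger0_norm b0) -!sqrtr_sqr ler_wsqrtr.
rewrite /norm1R /segment_point /=.
have z1 : z.1%:~R = c%:R :> R by rewrite zE /site_shift /= add0r.
have z2 : z.2%:~R = d%:R :> R by rewrite zE /site_shift /= add0r.
have x1' : x.1%:~R = p%:R :> R by rewrite xE /site_shift /= add0r.
have x2' : x.2%:~R = q%:R :> R by rewrite xE /site_shift /= add0r.
rewrite z1 z2 x1' x2' !mulr0 !add0r -cdR.
have -> : c%:R - (c%:R + d%:R) / n%:R * p%:R = X / n%:R.
  by rewrite -pqR /X; field; rewrite pqR gt_eqF.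
have -> : d%:R - (c%:R + d%:R) / n%:R * q%:R = - (X / n%:R).
  by rewrite -pqR /X; field; rewrite pqR gt_eqF.
rewrite normrN.
have -> : `|X / n%:R| = `|X| / n%:R by rewrite normrM normfV [`|n%:R|]ger0_norm.
have h : `|X| / n%:R <= eps * n%:R / 2.
  by rewrite ler_pdivrMr//; move: aX; rewrite expr2; lra.
lra.
Qed.

(** * Convergence in probability *)

(** [D] is a union of atoms of a finite partition. Splitting by the value of the first test, [D' v]
    forgets that test and depends on the remaining ones only. *)
Lemma measurable_finitely_determined d (T : measurableType d) (I : Type)
    (l : seq I) (b : I -> T -> bool) (D : set T) :
  (forall i, measurable [set t | b i t]) ->
  (forall t t', [seq b i t | i <- l] = [seq b i t' | i <- l] -> D t -> D t') ->
  measurable D.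
Proof.
move=> mb; elim: l D => [|i l IH] D HD.
  have [[t Dt]|nD] := pselect (exists t, D t).
    by rewrite (_ : D = setT)// predeqE => t'; split => // _; exact: (HD t).
  by rewrite (_ : D = set0)// predeqE => t; split => // Dt; apply: nD; exists t.
pose D' (v : bool) := [set t | exists t', [/\ D t', b i t' = v &
  [seq b j t' | j <- l] = [seq b j t | j <- l]]].
have mD' v : measurable (D' v).
  by apply: IH => t t' tt' [s [Ds bs st]]; exists s; split => //; rewrite st.
rewrite (_ : D = (D' true `&` [set t | b i t]) `|` (D' false `&` ~` [set t | b i t])).
  by apply: measurableU; apply: measurableI => //; exact: measurableC.
rewrite predeqE => t; split => [Dt|].
  by case E : (b i t); [left|right]; split; rewrite /= ?E//; exists t.
case=> -[[s [Ds bs st]]] /=.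
  by move=> bt; apply: HD Ds; rewrite /= bs bt st.
by move=> /negP/negPf bt; apply: HD Ds; rewrite /= bs bt st.
Qed.

Lemma measure_bigsetU_uniform d (T : measurableType d) (R : realType)
    (P : probability T R) (I : Type) (s : seq I) (F : I -> set T) (r : R) :
  (forall i, measurable (F i)) -> (forall i, P (F i) <= r%:E)%E ->
  (P (\big[setU/set0]_(i <- s) F i) <= ((size s)%:R * r)%:E)%E.
Proof.
move=> mF Fr; elim: s => [|i s IH]; first by rewrite big_nil measure0 mul0r.
rewrite big_cons; apply: (le_trans (measureU2 _ _ _)) => //.
  exact: bigsetU_measurable.
by rewrite /= -natr1 mulrDl mul1r addrC EFinD; apply: leeD.
Qed.

Section relative_deviation.
Context (R : realType) d (T : measurableType d) (P : probability T R).
Notation mR := (measurableTypeR R).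
Variable omega : site -> {RV P >-> R}.

Let env t : site -> R := fun v => omega v t.

(** The weights enter the deviation only through the chosen path, and [xget] makes the same choice
    from equal sets of maximizers. *)
Lemma max_relative_deviation_eq (w w' : site -> R) M :
  (forall p q, p \in paths_from M 0 -> q \in paths_from M 0 ->
    (path_weight w 0 p <= path_weight w 0 q) =
    (path_weight w' 0 p <= path_weight w' 0 q)) ->
  max_relative_deviation w M = max_relative_deviation w' M.
Proof.
move=> ww'; rewrite /max_relative_deviation; congr sup.
apply: eq_imagel => x [x1 x2 xM]; congr (_ / _).
rewrite /geodesic_deviation.
have x0 : site_le 0 x by rewrite /site_le x1 x2.
have pf p : up_right_paths 0 x p -> p \in paths_from M 0.
  move=> /mem_lattice_paths; rewrite mem_filter => /andP[_].
  by rewrite (_ : norm1Z (x - 0) = M)// subr0.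
suff -> : geodesic w 0 x = geodesic w' 0 x by [].
rewrite /geodesic; congr (_ :: xget _ _).
rewrite predeqE => p; rewrite !last_passageP//; split => -[pp pm]; split => // q qp.
  by rewrite -ww' ?pm//; exact: pf.
by rewrite ww' ?pm//; exact: pf.
Qed.

Lemma measurable_path_weight p : measurable_fun [set: T] (fun t => path_weight (env t) 0 p).
Proof. by apply: measurable_sum => v; exact: measurable_funP. Qed.

(* [xget] depends on the weights only through the set of maximizing paths, hence through
   finitely many comparisons of path weights. *)
Lemma measurable_relative_deviation M (Q : set R) :
  measurable [set t | Q (max_relative_deviation (env t) M)].
Proof.
pose l := [seq (p, q) | p <- paths_from M 0, q <- paths_from M 0].
pose b (pq : seq site * seq site) t :=
  path_weight (env t) 0 pq.1 <= path_weight (env t) 0 pq.2.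
apply: (measurable_finitely_determined (l := l) (b := b)).
  move=> pq.
  have h : measurable_fun [set: T] (b pq).
    by apply: measurable_fun_ler; exact: measurable_path_weight.
  by have := h measurableT [set true]; rewrite setTI preimage_true; apply.
move=> t t' tt' /=; rewrite (@max_relative_deviation_eq (env t) (env t'))// => p q pM qM.
have pql : (p, q) \in l by exact: allpairs_f.
by have /eq_in_map := tt'; move=> /(_ _ pql).
Qed.

Hypothesis omega_indep : mutually_independent omega.
Hypothesis omega_exp : forall v, has_exponential_law 1 (omega v).

Lemma omega_lt0_prob v : P [set t | omega v t < 0] = 0%E.
Proof.
have -> : [set t | omega v t < 0] = omega v @^-1` (~` `[0, +oo[%classic).
  by rewrite predeqE => t; rewrite /= in_itv/= andbT; split => [|/negP]; rewrite -?ltNge// ltNge => /negP.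
rewrite -[LHS]/(distribution P (omega v) _) omega_exp; last exact: measurableC.
rewrite -[LHS]/(exponential_law ltr01 _) probability_setC//.
rewrite (is_exp_ray true ltr01 (is_exp_exponential_law ltr01) (lexx 0)).
by rewrite mulr0 expR0 subee.
Qed.

(** There are countably many sites, so one null set serves them all; [unpickle] enumerates them. *)
Lemma omega_negative_null :
  exists B : set T, [/\ measurable B, P B = 0%E &
    forall t, ~ B t -> forall v, 0 <= omega v t].
Proof.
pose F k := if unpickle k is Some v then [set t | omega v t < 0] else set0.
have : P.-negligible (\bigcup_k F k).
  apply: negligible_bigcup => k; rewrite /F; case: unpickle => [v|]; last exact: negligible_set0.
  apply/negligibleP; last exact: omega_lt0_prob.
  rewrite (_ : [set t | _] = omega v @^-1` `]-oo, 0[%classic).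
    have h : measurable_fun [set: T] (omega v) by exact: measurable_funP.
    by apply: measurable_rv h _; exact: measurable_itv.
  by rewrite predeqE => t; rewrite /= in_itv.
move=> [B [mB PB FB]]; exists B; split => // t nB v; rewrite leNgt; apply/negP => tv.
have Fv : F (pickle v) t by rewrite /F pickleK.
by apply: nB; apply: FB; exists (pickle v).
Qed.

(** There are [3 * (n + 1) ^ 4] bad events, each of probability at most 4 times the exponential. The
    rate is that of [stationary_typical_prob] with [delta = eta ^ 2] and [lam0 = eta / 4]. *)
Lemma relative_deviation_prob (eta eps : R) (n : nat) :
  0 < eta -> eta <= 1 -> 0 < eps -> 30 * Num.sqrt eta <= eps ^+ 2 ->
  4 <= eta ^+ 2 * n.+1%:R ->
  (P [set t | (eps < `|max_relative_deviation (env t) n|)%R] <=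
   (12 * n.+1%:R ^+ 4 *
    expR (- (eta ^+ 6 / 128 * n.+1%:R)))%:E)%E.
Proof.
move=> eta0 eta1 eps0 etaeps big.
have [B0 [mB0 PB0 B0P]] := omega_negative_null.
pose K := ('I_n.+1 * 'I_n.+1 * 'I_n.+1 * 'I_n.+1 * 'I_3)%type.
pose bad (k : K) := let: (i, j, p, q, c) := k in
  [set t | ~ stationary_typical (env t) (eta ^+ 2 * n.+1%:R) (site_shift 0 i j) p q
     (slope eta n.+1%:R c p q)].
have badP k : measurable (bad k) /\
    (P (bad k) <= (4 * expR (- (eta ^+ 6 / 128 * n.+1%:R)))%:E)%E.
  case: k => [[[[i j] p] q] c].
  have pn : (p <= n)%N by rewrite -ltnS.
  have qn : (q <= n)%N by rewrite -ltnS.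
  have [s1 s2] := slope_range eta0 eta1 (erefl n.+1%:R) c pn qn.
  have := @stationary_typical_prob R _ T P omega (eta / 4) (eta ^+ 2) n.+1%:R
    (site_shift 0 i j) p q (slope eta n.+1%:R c p q) omega_indep omega_exp.
  have -> : (eta ^+ 2) ^+ 2 * (eta / 4) ^+ 2 / 8 = eta ^+ 6 / 128 by field.
  apply => //.
  - by rewrite divr_gt0.
  - lra.
  - exact: exprn_gt0.
  - by rewrite exprn_ile1// ltW.
  - by rewrite ler_nat ltnW.
  - by rewrite ler_nat ltnS.
pose U := \big[setU/set0]_(k <- enum {: K}) bad k.
have mU : measurable U by apply: bigsetU_measurable => k _; have [] := badP k.
have PU : (P U <= (12 * n.+1%:R ^+ 4 * expR (- (eta ^+ 6 / 128 * n.+1%:R)))%:E)%E.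
  apply: (le_trans (measure_bigsetU_uniform _ (fun k => (badP k).1) (fun k => (badP k).2))).
  rewrite -cardE !card_prod !card_ord !natrM lee_fin.
  by rewrite le_eqVlt; apply/orP; left; apply/eqP; ring.
apply: (@le_trans _ _ (P (B0 `|` U))); last first.
  apply: (le_trans (measureU2 P mB0 mU)).
  by rewrite [X in (X + _)%E](PB0 : P B0 = 0%E) add0e.
apply: le_measure; rewrite ?inE//.
- exact: (measurable_relative_deviation n (fun r => eps < `|r|)).
- exact: measurableU.
move=> t /=; apply: contraPP => /not_orP[nB0 nU].
have w0 := B0P t nB0.
have typ i j p q (c : 'I_3) : (i <= n)%N -> (j <= n)%N -> (p <= n)%N -> (q <= n)%N ->
    stationary_typical (env t) (eta ^+ 2 * n.+1%:R) (site_shift 0 i j) p q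
     (slope eta n.+1%:R c p q).
  move=> iN jN pN qN; apply: contrapT => nt; apply: nU.
  rewrite /U -bigcup_seq; exists (inord i, inord j, inord p, inord q, c).
    by rewrite /= mem_enum.
  by rewrite /bad !inordK.
have dev x : 0 <= x.1 -> 0 <= x.2 -> norm1Z x = n ->
    geodesic_deviation (env t) 0 x <= eps * n%:R.
  by move=> a b c; apply: (geodesic_deviation_typical eta0 eta1 eps0 etaeps w0 typ big a b c).
have n0 : 0 < n%:R :> R.
  have : eta ^+ 2 <= 1 by rewrite exprn_ile1// ltW.
  case: (n) big => [|m] big; last by rewrite ltr0n.
  by move: big; rewrite mulr1; lra.
apply/negP; rewrite -leNgt.
pose S := [set geodesic_deviation (env t) 0 x / (norm1Z x)%:R
        | x in [set x : site | [/\ 0 <= x.1, 0 <= x.2 & norm1Z x = n]]].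
have ubS : ubound S eps.
  by move=> _ [x [x1 x2 xn] <-]; rewrite xn ler_pdivrMr// dev.
(* A point of the set, which [ge_sup] requires to be nonempty; its nonnegative value also allows
   removing the absolute value. *)
pose x1 : site := (n%:Z, 0).
have Sx : S (geodesic_deviation (env t) 0 x1 / (norm1Z x1)%:R).
  by exists x1 => //; split => //=; rewrite /norm1Z/= addn0.
have sup0 : 0 <= max_relative_deviation (env t) n.
  apply: (@le_trans _ _ (geodesic_deviation (env t) 0 x1 / (norm1Z x1)%:R)).
    rewrite divr_ge0//; rewrite /geodesic_deviation.
    elim/big_ind: _ => // [a b a0 b0|i _]; first by rewrite le_max a0.
    by rewrite /norm1R addr_ge0.
  apply: ub_le_sup => //; by exists eps.
rewrite ger0_norm//; apply: ge_sup => //.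
by exists (geodesic_deviation (env t) 0 x1 / (norm1Z x1)%:R).
Qed.

End relative_deviation.

Lemma cvg_pow_expR0 (R : realType) (c : R) : 0 < c ->
  (12 * n.+1%:R ^+ 4 * expR (- (c * n.+1%:R)))%:E @[n --> \oo] --> (0 : \bar R).
Proof.
move=> c0.
pose K : R := 12 * (5 / c) ^+ 5.
apply: (@squeeze_cvge _ _ _ _ (fun=> 0%E) _ (fun n => (K * n.+1%:R^-1)%:E)).
- near=> n; apply/andP; split.
    by rewrite lee_fin !mulr_ge0 ?expR_ge0// exprn_ge0.
  rewrite lee_fin.
  set N : R := n.+1%:R; have N0 : 0 < N by rewrite ltr0n.
  have y0 : 0 < c * N / 5 by rewrite divr_gt0// mulr_gt0.
  (* The fifth power of [y <= expR y], one degree more than the polynomial factor, leaves a bound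
     [K / N]. *)
  have h : (c * N / 5) ^+ 5 <= expR (c * N).
    have -> : c * N = c * N / 5 * 5%:R by field.
    rewrite expRM_natr lerXn2r ?nnegrE ?expR_ge0//; first by rewrite mulfK ?ltW//.
    by rewrite mulfK//; have := expR_ge1Dx (c * N / 5); lra.
  rewrite expRN.
  apply: (@le_trans _ _ (12 * N ^+ 4 * ((c * N / 5) ^+ 5)^-1)).
    rewrite ler_wpM2l//; first by rewrite mulr_ge0// exprn_ge0// ltW.
    by rewrite lef_pV2 ?posrE ?expR_gt0// exprn_gt0.
  rewrite /K le_eqVlt; apply/orP; left; apply/eqP.
  by field; rewrite !gt_eqF.
- exact: cvg_cst.
apply: cvg_EFin; first by near=> n.
rewrite -(mulr0 K); apply: cvgMr; exact: cvg_harmonic.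
Unshelve. all: by end_near. Qed.

Theorem theorem3p8 (R : realType) (d : measure_display) (T : measurableType d)
    (P : probability T R) (omega : int * int -> {RV P >-> R})
    (omega_indep : mutually_independent omega)
    (omega_exp : forall x, has_exponential_law 1 (omega x)) :
  cvg_in_probability P
    (fun M t => max_relative_deviation (fun x => omega x t) M)
    (fun _ => 0).
Proof.
move=> eps eps0.
(* Chosen so that [eta = theta ^+ 2] satisfies [30 * sqrt eta <= eps ^+ 2] and [eta <= 1]. *)
pose theta : R := Num.min 1 (eps ^+ 2 / 30).
have th0 : 0 < theta by rewrite lt_min ltr01 divr_gt0// exprn_gt0.
have th1 : theta <= 1 by rewrite ge_min lexx.
pose eta := theta ^+ 2.
have eta0 : 0 < eta by exact: exprn_gt0.
have eta1 : eta <= 1 by rewrite exprn_ile1// ltW.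
have sq : Num.sqrt eta = theta by rewrite sqrtr_sqr ger0_norm// ltW.
have etaeps : 30 * Num.sqrt eta <= eps ^+ 2.
  rewrite sq; have : theta <= eps ^+ 2 / 30 by rewrite ge_min lexx orbT.
  lra.
apply: (@squeeze_cvge _ _ _ _ (fun=> 0%E) _
  (fun n => (12 * n.+1%:R ^+ 4 * expR (- (eta ^+ 6 / 128 * n.+1%:R)))%:E)).
- near=> n; rewrite measure_ge0 /=.
  under eq_set do rewrite subr0.
  apply: relative_deviation_prob => //.
  rewrite mulrC -ler_pdivrMr ?exprn_gt0//.
  apply: (@le_trans _ _ n%:R); last by rewrite ler_nat.
  near: n; exact: nbhs_infty_ger.
- exact: cvg_cst.
by apply: cvg_pow_expR0; rewrite divr_gt0// exprn_gt0.
Unshelve. all: by end_near. Qed.
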